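(* Let $\mathrm{x}\in\{\mathrm{r},\mathrm{w}\}$. Let $B,C,E>0$, $D\in(0,1)$, $1\le K_{\mathrm{low}}\le K_{\mathrm{up}}$ and $K>1$ be constants. For every $d\in\mathbb{N}$ let spaces $F^{(n)},G^{(n)}$, operators $S^{(n)}$ and building blocks $U^{(n)}_l$ that are randomized linear algorithms ($n=1,\dots,d$, $l\in\mathbb{N}$) be given such that, with the constants $B,C,E,D,K_{\mathrm{low}},K_{\mathrm{up}},K$ not depending on $d$, for all $n=1,\dots,d$ and $l\in\mathbb{N}$: (i) $\|S^{(n)}\|_{\mathrm{op}}\le B$ and $e^{\mathrm{x}}(S^{(n)},U^{(n)}_l)\le CD^l$; (ii) if $\mathrm{x}=\mathrm{r}$: $U^{(n)}_lf\in L^2(\Omega^{(n)},G^{(n)})$ for all $f\in F^{(n)}$, and $\sup_{\|f\|_{F^{(n)}}\le 1}\mathbb{E}[\|U^{(n)}_lf-U^{(n)}_{l-1}f\|^2]^{1/2}\le E D^l$; (iii) if $\mathrm{x}=\mathrm{w}$: $\mu_{l,n}(\omega_n):=\sup_{\|f\|_{F^{(n)}}\le1}\|(U^{(n)}_lf)(\omega_n)\|<\infty$ for all $\omega_n\in\Omega^{(n)}$, $\mu_{l,n}$ is measurable with $\|\mu_{l,n}\|_{L^2(\Omega^{(n)},\mathbb{R})}<\infty$, and $\mathbb{E}[\sup_{\|f\|_{F^{(n)}}\le 1}\|U^{(n)}_lf-U^{(n)}_{l-1}f\|^2]^{1/2}\le E D^l$; (iv) $K_{\mathrm{low}}K^{l-1}(K-1)\le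 m_{l,n}-m_{l-1,n}\le K_{\mathrm{up}}K^{l-1}(K-1)$. Put $\alpha:=\log(1/D)/\log(K)$. Let $A(L,d)$ be the corresponding randomized Smolyak methods and $N=N(L,d)$ the cardinality of information used by $A(L,d)$. Then there exist constants $C_0,C_1$, not depending on $d$ and $L$, such that for all $d\in\mathbb{N}$ and all $L\ge d$ it holds, for $d=1$, $$e^{\mathrm{x}}(S_1,A(L,1))\le C_0C_1N^{-\alpha},$$ and, for $d\ge2$, $$e^{\mathrm{x}}(S_d,A(L,d))\le C_0C_1^d\Big(1+\frac{\log(N)}{d-1}\Big)^{(d-1)(\alpha+1)}N^{-\alpha}.$$
   Context: $\mathbb{N}=\{1,2,\dots\}$. For $n=1,\dots,d$, $F^{(n)}$ is a separable Hilbert space of real-valued functions, $G^{(n)}$ is a separable Hilbert space, and $S^{(n)}:F^{(n)}\to G^{(n)}$ is a continuous linear operator. $F_d=F^{(1)}\otimes\cdots\otimes F^{(d)}$ and $G_d=G^{(1)}\otimes\cdots\otimes G^{(d)}$ are the Hilbert space tensor products and $S_d=S^{(1)}\otimes\cdots\otimes S^{(d)}:F_d\to G_d$. Norms on $G^{(n)}$ and $G_d$ are written $\|\cdot\|$. Randomized linear operator: for separable Hilbert spaces $F,G$ and a probability space $(\Omega,\Sigma,\mathbf{P})$, a map $A:\Omega\to L(F,G)$ (bounded linear operators) such that $\omega\mapsto A(\omega)f$, denoted $Af$, is a random variable with values in $G$ (Borel $\sigma$-field) for every $f\in F$. For a bounded linear $S:F\to G$, $$e^{\mathrm r}(S,A)=\sup_{\|f\|_F\le1}\mathbb{E}\big[\|(S-A)f\|^2\big]^{1/2},\qquad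 e^{\mathrm w}(S,A)=\mathbb{E}\Big[\sup_{\|f\|_F\le1}\|(S-A)f\|^2\Big]^{1/2}.$$ Algorithms: fix a class $\Lambda$ of bounded linear functionals on $F$ (admissible information). A deterministic linear algorithm is an operator in $L(F,G)$ given in the form $\phi\circ\mathcal{N}$ with $\mathcal{N}(f)=(\lambda_1(f),\dots,\lambda_\tau(f))$ for finitely many $\lambda_i\in\Lambda$ ($\mathcal{N}=0$ if $\tau=0$) and some map $\phi$; $\mathrm{card}^{\mathrm{det}}:=\tau$ is the number of functionals used. A randomized linear algorithm is a randomized linear operator $A$ for which each $A(\omega)$ is a deterministic linear algorithm and $\omega\mapsto\mathrm{card}^{\mathrm{det}}(A(\omega),F)$ is a random variable; $\mathrm{card}^{\mathrm{ran}}(A,F):=\mathbb{E}[\mathrm{card}^{\mathrm{det}}(A,F)]$. Building blocks: for each $n=1,\dots,d$, $(U^{(n)}_l)_{l\in\mathbb{N}}$ is a sequence of randomized linear algorithms $U^{(n)}_l:\Omega^{(n)}\to L(F^{(n)},G^{(n)})$ on a probability space $(\Omega^{(n)},\Sigma^{(n)},\mathbf{P}^{(n)})$. Put $U^{(n)}_0:=0$, $\Delta^{(n)}_l:=U^{(n)}_l-U^{(n)}_{l-1}$ for $l\in\mathbb{N}$, $m_{l,n}:=\mathrm{card}^{\mathrm{ran}}(U^{(n)}_l,F^{(n)})$, $m_{0,n}=0$. Let $(\Omega,\Sigma,\mathbf{P})$ be the product of the spaces $(\Omega^{(n)},\Sigma^{(n)},\mathbf{P}^{(n)})$. For $\mathbf{l}\in\mathbb{N}^d$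 write $|\mathbf{l}|=l_1+\dots+l_d$. Randomized Smolyak method of level $L\ge d$: the randomized linear operator on $\Omega$ $$A(L,d)(\omega)=\sum_{\mathbf{l}\in\mathbb{N}^d,\,|\mathbf{l}|\le L}\ \bigotimes_{n=1}^d\Delta^{(n)}_{l_n}(\omega_n)=\sum_{\substack{\mathbf{l}\in\mathbb{N}^d\\ L-d+1\le|\mathbf{l}|\le L}}(-1)^{L-|\mathbf{l}|}\binom{d-1}{L-|\mathbf{l}|}\bigotimes_{n=1}^dU^{(n)}_{l_n}(\omega_n).$$ It is regarded as a randomized linear algorithm via the last representation: for given $\omega$ it uses the functionals $\lambda_1\otimes\cdots\otimes\lambda_d$ for which there is $\mathbf{l}\in\mathbb{N}^d$ with $L-d+1\le|\mathbf{l}|\le L$ such that $\lambda_n$ is one of the functionals used by $U^{(n)}_{l_n}(\omega_n)$ for every $n$. $N(L,d)=\mathrm{card}^{\mathrm{ran}}(A(L,d),F_d)$ is the expected number of functionals used.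
   Formalization: For d ≥ 2 the bound is stated only when N ≥ 1; for N < 1 the factor 1 + log(N)/(d-1) can be zero or negative, and the claim fails e.g. at N = exp(-(d-1)), where the right-hand side vanishes while the error is positive. *)

(* Defs.v *)
From HB Require Import structures.
From mathcomp Require Import all_boot all_order all_algebra.
From mathcomp Require Import all_classical all_reals all_analysis.
From mathcomp Require Import measurable_realfun.

Set Implicit Arguments.
Unset Strict Implicit.
Unset Printing Implicit Defensive.

Import Order.TTheory GRing.Theory Num.Theory.
Import numFieldNormedType.Exports.

Local Open Scope classical_set_scope.
Local Open Scope ring_scope.

(* A real separable Hilbert space; completeness comes from the carrier. *)
Record hilbert (R : realType) := Hilbert {
  hcarrier :> completeNormedModType R;
  hdot : hcarrier -> hcarrier -> R;
  hdotC : forall x y, hdot x y = hdot y x;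
  hdot_linear : forall a x y z, hdot (a *: x + y) z = a * hdot x z + hdot y z;
  hdot_norm : forall x, hdot x x = `|x| ^+ 2;
  hseparable : exists2 A : set hcarrier, countable A & dense A }.

(* A separable Hilbert space whose elements are real-valued functions on X. *)
Record function_hilbert (R : realType) (X : Type) := FunctionHilbert {
  fspace :> hilbert R;
  feval : fspace -> X -> R;
  feval_linear : forall a f g t,
    feval (a *: f + g) t = a * feval f t + feval g t;
  feval_inj : injective feval }.

(* The space L(F, G), as a set of functions. *)
Definition bounded_linear (R : realType) (F G : normedModType R) :
    set (F -> G) :=
  [set T | linear T /\ continuous T].

(* A Hilbert space tensor product of a finite family, characterized up to    *)
(* isometry by the inner product of elementary tensors and by completeness:   *)
(* the span of the elementary tensors is dense.                               *)
Record hilbert_tensor (R : realType) (d : nat) (H : 'I_d -> hilbert R) :=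
  HilbertTensor {
  tspace :> hilbert R;
  tens : (forall n, H n) -> tspace;
  tens_linear : forall (n : 'I_d) (f : forall n, H n) a (u v : H n),
    tens (dfwith f n (a *: u + v)) =
    a *: tens (dfwith f n u) + tens (dfwith f n v);
  tens_dot : forall f g, hdot (tens f) (tens g) = \prod_n hdot (f n) (g n);
  tens_dense : dense [set y | exists m (c : 'I_m -> R)
    (f : 'I_m -> forall n, H n), y = \sum_i c i *: tens (f i)] }.

(* The bounded linear map with prescribed values on elementary tensors        *)
(* (unique by density; 0 if there is none).                                   *)
Definition tensor_lift (R : realType) (d : nat) (H : 'I_d -> hilbert R)
    (HT : hilbert_tensor H) (V : normedModType R)
    (g : (forall n, H n) -> V) : HT -> V :=
  xget (0 : HT -> V)
    [set W : HT -> V | bounded_linear W /\ forall f, W (tens HT f) = g f].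
Arguments tensor_lift {R d H} HT {V} g _.

Definition tensor_op (R : realType) (d : nat) (F G : 'I_d -> hilbert R)
    (FT : hilbert_tensor F) (GT : hilbert_tensor G)
    (T : forall n, F n -> G n) : FT -> GT :=
  tensor_lift FT (fun f => tens GT (fun n => T n (f n))).
Arguments tensor_op {R d F G} FT GT T _.

Definition tensor_functional (R : realType) (d : nat) (F : 'I_d -> hilbert R)
    (FT : hilbert_tensor F) (lam : forall n, F n -> R^o) : FT -> R^o :=
  tensor_lift FT (fun f => \prod_n (lam n (f n) : R)).
Arguments tensor_functional {R d F} FT lam _.

(* The information is the vector of the values alg_info i f; alg_card is the  *)
(* number of functionals used.                                                *)
Record det_algorithm (R : realType) (F G : hilbert R) (Lam : set (F -> R^o)) :=
  DetAlgorithm {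
  alg_op : F -> G;
  alg_bounded : bounded_linear alg_op;
  alg_card : nat;
  alg_info : 'I_alg_card -> F -> R^o;
  alg_admissible : forall i, Lam (alg_info i);
  alg_phi : 'rV[R]_alg_card -> G;
  alg_opE : forall f, alg_op f = alg_phi (\row_i alg_info i f) }.

Definition borel_measurable (R : realType) (G : normedModType R)
    (disp : measure_display) (Omega : measurableType disp) (X : Omega -> G) :=
  measurable_fun setT (X : Omega -> g_sigma_algebraType (@open G)).

Record rand_algorithm (R : realType) (F G : hilbert R) (Lam : set (F -> R^o))
    (disp : measure_display) (Omega : measurableType disp) := RandAlgorithm {
  ralg :> Omega -> det_algorithm G Lam;
  ralg_measurable : forall f, borel_measurable (fun w => alg_op (ralg w) f);
  ralg_card_measurable : measurable_fun setT (fun w => alg_card (ralg w)) }.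

(* The product sigma-algebra is generated by the sets depending measurably on *)
(* one coordinate.                                                            *)
Definition cylinders (d : nat) (disp : 'I_d -> measure_display)
    (Omega : forall n, measurableType (disp n)) : set (set (forall n, Omega n)) :=
  [set A | exists n, exists2 A_n : set (Omega n),
             measurable A_n & A = [set w | A_n (w n)]].
Arguments cylinders {d disp} Omega.

Definition product_space (d : nat) (disp : 'I_d -> measure_display)
    (Omega : forall n, measurableType (disp n)) :=
  g_sigma_algebraType (cylinders Omega).

Definition is_product_probability (R : realType) (d : nat)
    (disp : 'I_d -> measure_display) (Omega : forall n, measurableType (disp n))
    (Pn : forall n, probability (Omega n) R)
    (P : probability (product_space Omega) R) :=
  forall A : forall n, set (Omega n), (forall n, measurable (A n)) ->
    P [set w | forall n, A n (w n)] = (\prod_(n < d) Pn n (A n))%E.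

(* The two error criteria: r = Randomized, w = WorstCase. *)
Inductive error_kind := Randomized | WorstCase.

Definition ball_sup (R : realType) (F : normedModType R) (u : F -> \bar R) :
    \bar R :=
  ereal_sup [set u f | f in [set f | `|f| <= 1]].

Definition op_norm (R : realType) (F G : normedModType R) (T : F -> G) :
    \bar R :=
  ball_sup (fun f => `|T f|%:E).

(* Mean-square size of a random operator; the two cases differ in the order   *)
(* of the supremum over the unit ball and the expectation.                    *)
Definition mean_square (R : realType) (x : error_kind) (F G : normedModType R)
    (disp : measure_display) (Omega : measurableType disp)
    (P : probability Omega R) (T : Omega -> F -> G) : \bar R :=
  match x with
  | Randomized => ball_sup (fun f => sqrte (\int[P]_w (`|T w f| ^+ 2)%:E)%E)
  | WorstCase =>
      sqrte (\int[P]_w (ball_sup (fun f => (`|T w f| ^+ 2)%:E)))%E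
  end.

Definition error (R : realType) (x : error_kind) (F G : normedModType R)
    (disp : measure_display) (Omega : measurableType disp)
    (P : probability Omega R) (S : F -> G) (A : Omega -> F -> G) : \bar R :=
  mean_square x P (fun w => S - A w).

(* The data for a fixed number d of factors, which are indexed by 'I_d. The   *)
(* building blocks are the block n l with l >= 1; block n 0 is never used.    *)
Unset Implicit Arguments.
Record smolyak_setting (R : realType) (d : nat) := SmolyakSetting {
  fun_dom : 'I_d -> Type;
  source : forall n, function_hilbert R (fun_dom n);
  target : 'I_d -> hilbert R;
  solution : forall n, source n -> target n;
  solution_bounded : forall n, bounded_linear (solution n);
  info_class : forall n, set (source n -> R^o);
  info_class_bounded : forall n lam, info_class n lam -> bounded_linear lam;
  sample_disp : 'I_d -> measure_display;
  sample : forall n, measurableType (sample_disp n);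
  prob : forall n, probability (sample n) R;
  block : forall n, nat ->
    rand_algorithm (target n) (info_class n) (sample n);
  source_d : hilbert_tensor source;
  target_d : hilbert_tensor target;
  prob_d : probability (product_space sample) R;
  prob_d_product : is_product_probability prob prob_d }.
Set Implicit Arguments.

Arguments source {R d} s n.
Arguments target {R d} s n.
Arguments solution {R d} s n _.
Arguments info_class {R d} s n _.
Arguments sample_disp {R d} s n.
Arguments sample {R d} s n.
Arguments prob {R d} s n.
Arguments block {R d} s n l : rename.
Arguments source_d {R d} s.
Arguments target_d {R d} s.
Arguments prob_d {R d} s.

Section smolyak.
Context (R : realType) (d : nat) (X : smolyak_setting R d).

(* The operators of the building blocks, with U_0 = 0. *)
Definition block_op (n : 'I_d) (l : nat) (w : sample X n) :
    source X n -> target X n :=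
  if l is 0%N then 0 else alg_op (block X n l w).

(* Only used for l >= 1: at l = 0 the truncated l - 1 gives 0. *)
Definition block_diff (n : 'I_d) (l : nat) (w : sample X n) :
    source X n -> target X n :=
  block_op l w - block_op (l - 1) w.

(* m_{l,n}, with m_{0,n} = 0. *)
Definition block_card (l : nat) (n : 'I_d) : \bar R :=
  if l is 0%N then 0%E
  else (\int[prob X n]_w (alg_card (block X n l w))%:R%:E)%E.

Definition solution_d : source_d X -> target_d X :=
  tensor_op (source_d X) (target_d X) (solution X).

(* The index type {ffun 'I_d -> 'I_L.+1} loses nothing: l_n >= 1 for all n    *)
(* and |l| <= L force l_n <= L.                                               *)
Definition smolyak (L : nat) (w : product_space (sample X)) :
    source_d X -> target_d X :=
  \sum_(l : {ffun 'I_d -> 'I_L.+1} |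
         [forall n, (1 <= l n)%N] && (\sum_(n < d) l n <= L)%N)
    tensor_op (source_d X) (target_d X) (fun n => block_diff (l n) (w n)).

(* The functionals used by the combination formula                            *)
(*   \sum_(L - d + 1 <= |l| <= L) (-1)^(L - |l|) 'C(d - 1, L - |l|) (x)_n U_{l_n}, *)
(* as a set: functionals equal on the tensor product space are counted once.  *)
Definition smolyak_info (L : nat) (w : product_space (sample X)) :
    set (source_d X -> R^o) :=
  [set lam | exists l : 'I_d -> nat,
    [/\ forall n, (1 <= l n)%N,
        (L - d + 1 <= \sum_(n < d) l n <= L)%N &
        exists i : forall n, 'I_(alg_card (block X n (l n) (w n))),
          lam = tensor_functional (source_d X) (fun n => alg_info (i n))]].

(* Measurability of the cardinality in w is not imposed; \int is then the      *)
(* supremum of the integrals of the simple functions below it.                *)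
Definition smolyak_card (L : nat) : \bar R :=
  (\int[prob_d X]_w counting (smolyak_info L w))%E.

End smolyak.

Arguments block_op {R d} X n l w _.
Arguments block_card {R d} X l n.
Arguments solution_d {R d} X _.
Arguments smolyak {R d} X L w _.
Arguments smolyak_card {R d} X L.

(* Main.v *)
Require Import Defs.
From mathcomp Require Import all_boot all_order all_algebra.
From mathcomp Require Import all_classical all_reals all_analysis.
From mathcomp Require Import measurable_realfun.
From mathcomp Require Import finmap ring lra zify.

(* The difference S_d - A(L,d) telescopes over the coordinates: it is the sum, *)
(* over k and over the multi-indices l with |l| = L and l_n = 1 for n > k, of  *)
(* the tensor products of Delta_{l_n} (n < k), S - U_{l_k} and S (n > k).      *)
(* The mean square of a tensor product of independent operators is at most     *)
(* the product of the mean squares: for x = w because the operator norm of a   *)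
(* tensor product is at most the product of the norms, for x = r by Schur's    *)
(* product theorem applied to the expected Gram matrices. Hence each term is   *)
(* at most H^d D^L, and by Chernoff's bound there are at most                  *)
(* d (e (1 + L/(d-1)))^(d-1) of them; the expected number of functionals is at *)
(* most M^d (e (1 + L/(d-1)))^(d-1) K^L. Eliminating L gives the claim. No     *)
(* lower bound on N enters for d >= 2 (functionals may coincide), because the  *)
(* claimed bound first increases and then decreases in log N.                  *)

Set Implicit Arguments.
Unset Strict Implicit.
Unset Printing Implicit Defensive.

Import Order.TTheory GRing.Theory Num.Theory.
Import numFieldNormedType.Exports.

Local Open Scope classical_set_scope.
Local Open Scope ring_scope.

(** * Schur products of positive semidefinite matrices *)

(** Error. Let P_k be the sum, over the multi-indices with |l| <= L and l_n = 1 for n >= k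
    (coordinates numbered from 0), of the tensor products with Delta_{l_n} in the slots n < k and S
    in the others. Then P_0 = S_d and P_d = A(L,d). Summing Delta over slot k turns P_k - P_{k+1}
    into a sum of terms with S - U_j in slot k, where j is what the other entries leave of L
    ([tens_telescope], [smolyak_decomposition]). The levels in such a term add up to exactly L, each
    S counting as level 1, so the term is at most H^d D^L ([mean_square_factors]).

    This needs multiplicativity of the error criterion ([mean_square_tensor]). In the worst case
    setting the operator norms multiply pointwise and are independent. In the randomized setting a
    bound t_n says that the expected Gram matrix of the images lies below t_n^2 times the Gram
    matrix of the arguments in the Loewner order. Independence makes expected Gram matrices of
    elementary tensors entrywise products, and Schur's theorem keeps the order ([loewner_prod]);
    Fatou's lemma passes from finite sums of elementary tensors to all vectors.

    Cost. The expected number of functionals is at most Kup^d times the sum of K^|l| over |l| <= L.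
    A geometric series in the last coordinate leaves a multiple of K^L times the number of indices
    with last entry 1 ([sum_admissible_exp]). The same number controls the error terms, and
    Chernoff's bound estimates it ([card_admissible_le]).

    Elimination of L. With m = d - 1, q = L ln K / m and s = ln N / m, both bounds are m-th powers
    up to constants to the power d. What remains is a one-variable inequality between q and s
    ([tradeoff]). For d = 1 it suffices that D^L = (K^L)^(-alpha) and N > 0. *)

Section schur.
Context {R : realFieldType} {I : finType}.
Implicit Types (A B : I -> I -> R) (x : I -> R).

Definition qform A x := \sum_i \sum_j x i * x j * A i j.

Definition psd A := (forall i j, A i j = A j i) /\ forall x, 0 <= qform A x.

(** The Loewner order. Positive semidefiniteness of the smaller matrix is included because
    [loewnerM] uses it as a factor in an entrywise product. *)
Definition loewner A B := psd A /\ psd (fun i j => B i j - A i j).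

Lemma qformD A B x : qform (fun i j => A i j + B i j) x = qform A x + qform B x.
Proof.
rewrite /qform -big_split; apply: eq_bigr => i _; rewrite -big_split.
by apply: eq_bigr => j _; rewrite mulrDr.
Qed.

Lemma qformN A x : qform (fun i j => - A i j) x = - qform A x.
Proof.
rewrite /qform -sumrN; apply: eq_bigr => i _; rewrite -sumrN.
by apply: eq_bigr => j _; rewrite mulrN.
Qed.

Lemma qform_rank1 (v : I -> R) x :
  qform (fun i j => v i * v j) x = (\sum_i x i * v i) ^+ 2.
Proof.
rewrite expr2 mulr_suml; apply: eq_bigr => i _.
by rewrite mulr_sumr; apply: eq_bigr => j _; ring.
Qed.

(** Moving [x] along one basis vector makes the form a quadratic polynomial in [t]; suitable values
    of [t] give the inequalities below. *)
Lemma qform_shift A (a : I) x t : (forall i j, A i j = A j i) ->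
  qform A (fun i => x i + t * (i == a)%:R) =
  qform A x + 2 * t * (\sum_i x i * A i a) + t ^+ 2 * A a a.
Proof.
move=> symA; have pick (f : I -> R) : \sum_i (i == a)%:R * f i = f a.
  rewrite (bigD1 a) //= eqxx mul1r big1 ?addr0 // => i /negbTE ->.
  by rewrite mul0r.
have -> : qform A (fun i => x i + t * (i == a)%:R) =
  qform A x + (t * \sum_i \sum_j (i == a)%:R * (x j * A i j) +
  (t * \sum_i \sum_j (j == a)%:R * (x i * A i j) +
  t ^+ 2 * \sum_i \sum_j (i == a)%:R * ((j == a)%:R * A i j))).
  rewrite /qform !mulr_sumr -!big_split; apply: eq_bigr => i _ /=.
  rewrite !mulr_sumr -!big_split; apply: eq_bigr => j _ /=; ring.
have -> : \sum_i \sum_j (i == a)%:R * (x j * A i j) = \sum_i x i * A i a.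
  under eq_bigr do rewrite -mulr_sumr.
  by rewrite pick; apply: eq_bigr => i _; rewrite symA.
have -> : \sum_i \sum_j (j == a)%:R * (x i * A i j) = \sum_i x i * A i a.
  by apply: eq_bigr => i _; rewrite pick.
have -> : \sum_i \sum_j (i == a)%:R * ((j == a)%:R * A i j) = A a a.
  under eq_bigr do rewrite -mulr_sumr.
  by rewrite pick pick.
by ring.
Qed.

Lemma psd_diag A i : psd A -> 0 <= A i i.
Proof.
move=> [symA A0].
have := A0 (fun j => 0 + 1 * (j == i)%:R).
rewrite qform_shift // /qform big1 => [|k _]; last first.
  by rewrite big1 // => j _; rewrite !mul0r.
rewrite big1 => [|k _]; last by rewrite mul0r.
by rewrite mulr0 !add0r expr1n mul1r.
Qed.

(* Nonnegativity of the quadratic polynomial [t |-> qform A (x + t e_a)]. *)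
Lemma psd_disc A a x : psd A -> (\sum_i x i * A i a) ^+ 2 <= qform A x * A a a.
Proof.
move=> psdA; have [symA A0] := psdA; set s := \sum_i _.
have [Aaa0|Aaa0] := eqVneq (A a a) 0.
  rewrite Aaa0 mulr0; have [->|s0] := eqVneq s 0; first by rewrite expr0n.
  (* With a zero diagonal entry the polynomial is affine in t; this t would give it the value -1. *)
  have := A0 (fun i => x i + (- (1 + qform A x) / (2 * s)) * (i == a)%:R).
  rewrite qform_shift // Aaa0 mulr0 addr0 -/s.
  have -> : 2 * (- (1 + qform A x) / (2 * s)) * s = - (1 + qform A x) by field.
  by lra.
have Aa : 0 < A a a by rewrite lt_def Aaa0 psd_diag.
(* This t is the minimizer of the polynomial. *)
have := A0 (fun i => x i + (- s / A a a) * (i == a)%:R).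
rewrite qform_shift // -/s => h.
have : 0 <= qform A x * A a a - s ^+ 2.
  suff -> : qform A x * A a a - s ^+ 2 = A a a *
    (qform A x + 2 * (- s / A a a) * s + (- s / A a a) ^+ 2 * A a a).
    by rewrite mulr_ge0 // ltW.
  by field.
by rewrite subr_ge0.
Qed.

Lemma psd0_entry A i j : psd A -> A i i = 0 -> A i j = 0.
Proof.
move=> psdA Ai0.
have := @psd_disc A i (fun k => (k == j)%:R) psdA; rewrite Ai0 mulr0.
rewrite (bigD1 j) //= eqxx mul1r big1 ?addr0 => [|k /negbTE ->]; last first.
  by rewrite mul0r.
by have [symA _] := psdA; rewrite (symA j i) => h; apply/eqP;
  rewrite -sqrf_eq0 eq_le h sqr_ge0.
Qed.

(* Schur's product theorem: A is a sum of rank one matrices v v^T, split off  *)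
(* one at a time, and (v v^T o B) is congruent to B.                          *)
Lemma psdM A B : psd A -> psd B -> psd (fun i j => A i j * B i j).
Proof.
move=> psdA psdB; split=> [i j|x].
  by rewrite (proj1 psdA) (proj1 psdB).
(* Induction on the number of nonzero diagonal entries. If there are none, [A] vanishes; splitting
   off a rank one matrix creates a new zero and keeps the old ones. *)
have [n] := ubnP #|[pred i | A i i != 0]|.
elim: n A psdA => // n IH A psdA; rewrite ltnS => An.
have [symA A0] := psdA.
have [/existsP[a Aa]|] := boolP [exists a, A a a != 0]; last first.
  rewrite negb_exists => /forallP h; rewrite /qform big1 // => i _.
  rewrite big1 // => j _; rewrite psd0_entry ?mul0r ?mulr0 //.
  by apply/eqP; rewrite -[_ == _]negbK h.
have Aa0 : 0 < A a a by rewrite lt_def Aa psd_diag.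
(* The Schur complement of the entry (a, a), extended by a zero row and column; [psd_disc] says that
   it is positive semidefinite. *)
pose A' i j := A i j - A i a * A j a / A a a.
have psdA' : psd A'.
  split=> [i j|y]; first by rewrite /A' symA [A i a * _]mulrC.
  rewrite /A' qformD qformN.
  have -> : qform (fun i j => A i a * A j a / A a a) y =
      (\sum_i y i * A i a) ^+ 2 / A a a.
    rewrite -qform_rank1 /qform mulr_suml; apply: eq_bigr => i _.
    by rewrite mulr_suml; apply: eq_bigr => j _; rewrite mulrA.
  by rewrite subr_ge0 ler_pdivrMr // psd_disc.
have -> : qform (fun i j => A i j * B i j) x =
    qform (fun i j => A' i j * B i j) x +
    (A a a)^-1 * qform B (fun i => x i * A i a).
  rewrite /qform mulr_sumr -big_split; apply: eq_bigr => i _ /=.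
  rewrite mulr_sumr -big_split; apply: eq_bigr => j _ /=.
  by rewrite /A'; ring.
rewrite addr_ge0 ?mulr_ge0 ?invr_ge0 ?(ltW Aa0) ?(proj2 psdB) //.
apply: IH => //; apply: leq_trans An; apply: proper_card; apply/properP; split.
  apply/fintype.subsetP => i; rewrite !inE; apply: contraNN => /eqP Ai0.
  by rewrite /A' Ai0 psd0_entry // !mul0r subr0.
by exists a; rewrite !inE ?Aa // /A' mulfK ?subrr ?eqxx.
Qed.

Lemma psd_ext A B : (forall i j, A i j = B i j) -> psd A -> psd B.
Proof.
move=> AB [symA A0]; split=> [i j|x]; first by rewrite -!AB.
by have := A0 x; rewrite /qform;
  under eq_bigr do under eq_bigr do rewrite AB.
Qed.

Lemma psdD A B : psd A -> psd B -> psd (fun i j => A i j + B i j).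
Proof.
move=> [sA pA] [sB pB]; split=> [i j|x]; first by rewrite sA sB.
by rewrite qformD addr_ge0.
Qed.

Lemma loewner_psd A B : loewner A B -> psd B.
Proof.
by move=> [pA pBA]; apply: psd_ext (psdD pA pBA) => i j; rewrite addrC subrK.
Qed.

(** Entrywise, A'B' - AB = (A' - A)B' + A(B' - B), and both products are positive semidefinite by
    [psdM]. *)
Lemma loewnerM A A' B B' : loewner A A' -> loewner B B' ->
  loewner (fun i j => A i j * B i j) (fun i j => A' i j * B' i j).
Proof.
move=> lA lB; have pB' := loewner_psd lB; case: lA lB => pA pA' [pB pBB'].
split; first exact: psdM.
apply: psd_ext (psdD (psdM pA' pB') (psdM pA pBB')) => i j; ring.
Qed.

Lemma loewner_ext A A' B B' : (forall i j, A i j = A' i j) ->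
  (forall i j, B i j = B' i j) -> loewner A B -> loewner A' B'.
Proof.
move=> AA' BB' [pA pB]; split; first exact: psd_ext pA.
by apply: psd_ext pB => i j; rewrite AA' BB'.
Qed.

Lemma psd1 : psd (fun _ _ : I => 1).
Proof.
split=> // x; rewrite (_ : qform _ x = qform (fun i j => 1 * 1) x).
  by rewrite (qform_rank1 (fun=> 1)) sqr_ge0.
by rewrite /qform mulr1.
Qed.

Lemma loewner_prod (J : finType) (A B : J -> I -> I -> R) :
  (forall n, loewner (A n) (B n)) ->
  loewner (fun i j => \prod_n A n i j) (fun i j => \prod_n B n i j).
Proof.
move=> AB; elim: (index_enum J) => [|n s IH].
  apply: (@loewner_ext (fun _ _ => 1) _ (fun _ _ => 1)) => [i j|i j|].
  - by rewrite big_nil.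
  - by rewrite big_nil.
  split; first exact: psd1.
  split=> [i j //|x].
  by rewrite /qform big1 // => i _; rewrite big1 // => j _; rewrite subrr mulr0.
by apply: loewner_ext (loewnerM (AB n) IH) => i j; rewrite big_cons.
Qed.

End schur.

(** * Bounded linear maps *)

Section linear_maps.
Context {R : realType}.
Implicit Types F G : normedModType R.

Lemma linear_zero (F G : lmodType R) (T : F -> G) : linear T -> T 0 = 0.
Proof.
by move=> linT; have := linT (-1) 0 0; rewrite scaler0 addr0 scaleN1r addNr.
Qed.

Lemma linear_lincomb (F G : lmodType R) (T : F -> G) (I : Type) (r : seq I)
    (P : pred I) (c : I -> R) (x : I -> F) : linear T ->
  T (\sum_(i <- r | P i) c i *: x i) = \sum_(i <- r | P i) c i *: T (x i).
Proof.
move=> linT; elim: r => [|i r IH]; first by rewrite !big_nil linear_zero.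
by rewrite !big_cons; case: (P i); rewrite ?linT IH.
Qed.

Lemma linear_scale (F G : lmodType R) (T : F -> G) a x : linear T ->
  T (a *: x) = a *: T x.
Proof. by move=> linT; have := linT a x 0; rewrite !addr0 linear_zero // addr0. Qed.

Lemma linear_add (F G : lmodType R) (T : F -> G) x y : linear T ->
  T (x + y) = T x + T y.
Proof. by move=> linT; have := linT 1 x y; rewrite !scale1r. Qed.

Lemma linear_sub (F G : lmodType R) (T : F -> G) x y : linear T ->
  T (x - y) = T x - T y.
Proof.
by move=> linT; rewrite linear_add // -scaleN1r linear_scale // scaleN1r.
Qed.

Lemma le_bounded_linear F G (T : F -> G) (M : R) : linear T ->
  (forall x, `|T x| <= M * `|x|) -> bounded_linear T.
Proof.
move=> linT TM; split=> // x; apply/cvgrPdist_lt => e e0.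
have M0 : 0 < `|M| + 1 by rewrite ltr_wpDl.
near=> y; rewrite -linear_sub //; apply: (le_lt_trans (TM _)).
apply: (@le_lt_trans _ _ ((`|M| + 1) * `|x - y|)).
  by rewrite ler_wpM2r //; have := ler_norm M; lra.
rewrite mulrC -ltr_pdivlMr //.
by near: y; apply: cvgr_dist_lt => //; rewrite divr_gt0.
Unshelve. all: by end_near. Qed.

Lemma bounded_linear_bound F G (T : F -> G) : bounded_linear T ->
  exists2 M : R, 0 <= M & forall x, `|T x| <= M * `|x|.
Proof.
move=> [linT contT]; have := contT 0; rewrite /continuous_at.
rewrite (linear_zero linT) => /cvgrPdist_lt.
move=> /(_ 1 ltr01)/nbhs_ballP[/= e e0 eT].
exists (2 / e); first by rewrite divr_ge0 // ltW.
move=> x; have [->|x0] := eqVneq x 0; first by rewrite linear_zero // !normr0 mulr0.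
have nx0 : 0 < `|x| by rewrite normr_gt0.
(* The vector is rescaled to norm e / 2, inside the ball on which |T| < 1. *)
have := eT ((e / (2 * `|x|)) *: x).
rewrite -ball_normE /= !sub0r !normrN (linear_scale _ _ linT).
rewrite (normrZ _ x) (normrZ _ (T x)).
have ex0 : 0 < e / (2 * `|x|) by rewrite divr_gt0 // mulr_gt0.
rewrite (gtr0_norm ex0).
have -> : e / (2 * `|x|) * `|x| = e / 2 by field; rewrite gt_eqF.
have e2 : e / 2 < e by rewrite ltr_pdivrMr // ltr_pMr // ltr1n.
move=> /(_ e2) h; rewrite -ler_pdivrMl; last by rewrite divr_gt0.
rewrite -(@ler_pM2l _ (`|x|^-1)) ?invr_gt0 //.
rewrite mulVf ?gt_eqF //; apply: ltW; apply: le_lt_trans h.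
by rewrite le_eqVlt; apply/orP; left; apply/eqP; field; rewrite !gt_eqF.
Qed.

Lemma bounded_linear0 F G : bounded_linear (0 : F -> G).
Proof.
apply: (@le_bounded_linear _ _ _ 0) => [a x y|x] /=; rewrite /GRing.zero /=.
  by rewrite scaler0 addr0.
by rewrite normr0 mul0r.
Qed.

Lemma bounded_linearD F G (T U : F -> G) : bounded_linear T ->
  bounded_linear U -> bounded_linear (T + U).
Proof.
move=> [lT cT] [lU cU]; split=> [a x y|x]; rewrite /GRing.add /=.
  by rewrite lT lU scalerDr addrACA.
by apply: cvgD; [exact: cT|exact: cU].
Qed.

Lemma bounded_linearN F G (T : F -> G) : bounded_linear T ->
  bounded_linear (- T).
Proof.
move=> [lT cT]; split=> [a x y|x]; rewrite /GRing.opp /=.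
  by rewrite lT opprD scalerN.
by apply: cvgN; exact: cT.
Qed.

Lemma bounded_linearB F G (T U : F -> G) : bounded_linear T ->
  bounded_linear U -> bounded_linear (T - U).
Proof. by move=> bT bU; apply/bounded_linearD => //; exact: bounded_linearN. Qed.

Lemma bounded_linear_sum F G (I : Type) (r : seq I) (P : pred I)
    (T : I -> F -> G) : (forall i, P i -> bounded_linear (T i)) ->
  bounded_linear (\sum_(i <- r | P i) T i).
Proof.
move=> bT; apply: (big_ind (fun T : F -> G => bounded_linear T)) => //.
- exact: bounded_linear0.
- exact: bounded_linearD.
Qed.

Lemma denseP F (A : set F) : dense A <->
  forall x e, 0 < e -> exists2 a, A a & `|x - a| < e.
Proof.
split=> [dA x e e0|dA O [x Ox] oO].
  have [|a [/= xa Aa]] := dA (ball x e) _ (ball_open x _).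
    by exists x; exact: ballxx.
  by exists a => //; move: xa; rewrite -ball_normE.
have /nbhs_ballP[e /= e0 eO] : nbhs x O by apply: open_nbhs_nbhs; split.
have [a Aa xa] := dA x e e0; exists a; split => //.
by apply: eO; rewrite -ball_normE.
Qed.

Lemma bounded_linear_eq_dense F G (T U : F -> G) (A : set F) :
  bounded_linear T -> bounded_linear U -> dense A ->
  (forall x, A x -> T x = U x) -> T = U.
Proof.
move=> bT bU /denseP dA TU; apply/funext => x; apply/eqP; rewrite -subr_eq0.
have bD := bounded_linearB bT bU; have [M M0 DM] := bounded_linear_bound bD.
rewrite -normr_le0; apply/ler_addgt0Pr => e e0; rewrite add0r.
have M1 : 0 < M + 1 by rewrite ltr_wpDl.
have [a Aa xa] := dA x (e / (M + 1)) (divr_gt0 e0 M1).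
have -> : T x - U x = (T - U) (x - a).
  rewrite (linear_sub x a (proj1 bD)).
  by rewrite (_ : (T - U) a = T a - U a) // (TU _ Aa) subrr subr0.
apply: (le_trans (DM _)); apply: (@le_trans _ _ (M * (e / (M + 1)))).
  by rewrite ler_wpM2l // ltW.
by rewrite mulrA ler_pdivrMr // mulrC ler_pM2l // lerDl.
Qed.

(* The graph of the extension is the closure of the given graph. *)
Lemma dense_extension F (G : completeNormedModType R) (Gamma : F -> G -> Prop)
    (M : R) : 0 <= M ->
  (forall a x y x' y', Gamma x y -> Gamma x' y' ->
     Gamma (a *: x + x') (a *: y + y')) ->
  (forall x y, Gamma x y -> `|y| <= M * `|x|) ->
  dense [set x | exists y, Gamma x y] ->
  exists T : F -> G, [/\ bounded_linear T,
    forall x, `|T x| <= M * `|x| & forall x y, Gamma x y -> T x = y].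
Proof.
move=> M0 linG GM /denseP dG.
pose Q x y := forall e, 0 < e ->
  exists a b, [/\ Gamma a b, `|x - a| < e & `|y - b| < e].
have Qlin a x y x' y' : Q x y -> Q x' y' -> Q (a *: x + x') (a *: y + y').
  move=> Qx Qx' e e0; pose d := e / (2 * (`|a| + 1)).
  have a1 : 0 < `|a| + 1 by rewrite ltr_wpDl.
  have d0 : 0 < d by rewrite divr_gt0 // mulr_gt0.
  have e20 : 0 < e / 2 by rewrite divr_gt0.
  have [u [v [uv xu yv]]] := Qx d d0.
  have [u' [v' [uv' xu' yv']]] := Qx' _ e20.
  have key (V : normedModType R) (s t s' t' : V) : `|s - t| < d ->
      `|s' - t'| < e / 2 -> `|a *: s + s' - (a *: t + t')| < e.
    move=> st st'; rewrite opprD addrACA -scalerBr.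
    apply: (le_lt_trans (ler_normD _ _)); rewrite normrZ [e in _ < e]splitr.
    rewrite ler_ltD //; apply: (@le_trans _ _ (`|a| * d)).
      by rewrite ler_wpM2l // ltW.
    rewrite /d mulrA ler_pdivrMr ?mulr_gt0 //.
    have : `|a| * e <= (`|a| + 1) * e by rewrite ler_pM2r // lerDl.
    by have := normr_ge0 a; nra.
  exists (a *: u + u'), (a *: v + v'); split; [exact: linG|exact: key..].
have QM x y : Q x y -> `|y| <= M * `|x|.
  move=> Qx; apply/ler_addgt0Pr => e e0.
  have M1 : 0 < M + 1 by rewrite ltr_wpDl.
  have [u [v [uv xu yv]]] := Qx _ (divr_gt0 e0 M1).
  have -> : y = (y - v) + v by rewrite subrK.
  apply: (le_trans (ler_normD _ _)).
  have h1 := GM _ _ uv; have h2 : `|u| <= `|x| + e / (M + 1).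
    have -> : u = x - (x - u) by rewrite subKr.
    by apply: (le_trans (ler_normB _ _)); rewrite lerD2l ltW.
  have h3 : M * `|u| <= M * (`|x| + e / (M + 1)) by rewrite ler_wpM2l.
  have h4 : (M + 1) * (e / (M + 1)) = e by field; rewrite gt_eqF.
  by move: (ltW yv) h1 h3 h4; set z := e / (M + 1); nra.
(* Points of the given domain converging to x have Cauchy images by the norm bound; completeness of
   [G] supplies the limit. *)
have Qex x : exists y, Q x y.
  have /choice[a aP] : forall k : nat, exists p : F * G,
      Gamma p.1 p.2 /\ `|x - p.1| < k.+1%:R^-1.
    move=> k; have [|a [b ab] xa] := dG x (k.+1%:R^-1).
      by rewrite invr_gt0.
    by exists (a, b).
  pose b k := (a k).2.
  have bM i j : `|b i - b j| <= M * `|(a i).1 - (a j).1|.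
    have swap (V : lmodType R) (u v : V) : u - v = -1 *: v + u.
      by rewrite scaleN1r addrC.
    apply: GM; rewrite (swap _ (b i)) (swap _ (a i).1).
    by apply: linG; apply: (proj1 (aP _)).
  have M1 : 0 < M + 1 by rewrite ltr_wpDl.
  have near_inv e : 0 < e -> \forall k \near \oo, k.+1%:R^-1 < e :> R.
    by move=> e0; exact: near_infty_natSinv_lt (PosNum e0).
  have : cauchy (b @ \oo).
    apply: cauchy_exP => e e0.
    have d0 : 0 < e / (2 * (M + 1)) by rewrite divr_gt0 // mulr_gt0.
    have [N _ NP] := near_inv _ d0.
    exists (b N); exists N => // k /= Nk; rewrite -ball_normE /=.
    apply: (le_lt_trans (bM _ _)).
    have h : `|(a N).1 - (a k).1| <= 2 * (e / (2 * (M + 1))).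
      have -> : (a N).1 - (a k).1 = (x - (a k).1) - (x - (a N).1).
        by rewrite opprB [RHS]addrC addrA subrK.
      apply: (le_trans (ler_normB _ _)).
      have := lt_trans (proj2 (aP k)) (NP k Nk).
      have := lt_trans (proj2 (aP N)) (NP N (leqnn _)); lra.
    have h4 : (M + 1) * (2 * (e / (2 * (M + 1)))) = e by field; rewrite gt_eqF.
    have : M * `|(a N).1 - (a k).1| <= M * (2 * (e / (2 * (M + 1)))).
      by rewrite ler_wpM2l.
    by move: d0 h4; set z := e / _; nra.
  move=> /cauchy_cvg/cvg_ex[y by_]; exists y => e e0.
  have /cvgrPdist_lt/(_ e e0)[N1 _ N1P] := by_.
  have [N2 _ N2P] := near_inv _ e0.
  pose N := maxn N1 N2; exists (a N).1, (a N).2; split.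
  - exact: (proj1 (aP N)).
  - by apply: (lt_trans (proj2 (aP N))); apply: N2P => /=; rewrite leq_maxr.
  - by apply: N1P => /=; rewrite leq_maxl.
have /choice[T TQ] := Qex.
(* The difference of two values at x is a value at 0, where the norm bound forces 0. *)
have Quniq x y y' : Q x y -> Q x y' -> y = y'.
  move=> Qy Qy'; have := QM _ _ (Qlin (-1) _ _ _ _ Qy' Qy).
  rewrite !scaleN1r addNr normr0 mulr0 normr_le0 addrC subr_eq0.
  by move/eqP.
have GQ x y : Gamma x y -> Q x y.
  by move=> Gxy e e0; exists x, y; rewrite !subrr !normr0; split.
exists T; split.
- apply: (@le_bounded_linear _ _ _ M) => [a x y|x]; last exact: QM.
  by apply: Quniq (TQ _) _; exact: Qlin.
- by move=> x; exact: QM.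
- by move=> x y /GQ Qxy; exact: Quniq Qxy.
Qed.

End linear_maps.

(** * Tensor products of bounded linear maps *)

Section hilbert_theory.
Context {R : realType}.
Implicit Types H G : hilbert R.

Lemma hdot0l H (z : H) : hdot 0 z = 0.
Proof.
by have := hdot_linear (-1) 0 0 z; rewrite scaler0 addr0 mulN1r addNr.
Qed.

Lemma hdotDl H (x y z : H) : hdot (x + y) z = hdot x z + hdot y z.
Proof. by have := hdot_linear 1 x y z; rewrite scale1r mul1r. Qed.

Lemma hdotZl H a (x z : H) : hdot (a *: x) z = a * hdot x z.
Proof. by have := hdot_linear a x 0 z; rewrite !addr0 hdot0l addr0. Qed.

Lemma hdotNl H (x z : H) : hdot (- x) z = - hdot x z.
Proof. by rewrite -scaleN1r hdotZl mulN1r. Qed.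

Lemma hdotDr H (x y z : H) : hdot z (x + y) = hdot z x + hdot z y.
Proof. by rewrite !(hdotC z) hdotDl. Qed.

Lemma hdotNr H (x z : H) : hdot z (- x) = - hdot z x.
Proof. by rewrite !(hdotC z) hdotNl. Qed.

Lemma hdot_suml H (I : finType) (c : I -> R) (x : I -> H) z :
  hdot (\sum_i c i *: x i) z = \sum_i c i * hdot (x i) z.
Proof.
elim/big_rec2: _ => [|i y1 y2 _ <-]; first exact: hdot0l.
exact: hdot_linear.
Qed.

Lemma hdot_polar H (x y : H) :
  hdot x y = (`|x + y| ^+ 2 - `|x - y| ^+ 2) / 4.
Proof.
rewrite -!hdot_norm !(hdotDl, hdotDr, hdotNl, hdotNr) (hdotC y x).
by field.
Qed.

Lemma norm_sum_sqr H (I : finType) (c : I -> R) (x : I -> H) :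
  `|\sum_i c i *: x i| ^+ 2 = qform (fun i j => hdot (x i) (x j)) c.
Proof.
rewrite -hdot_norm hdot_suml /qform; apply: eq_bigr => i _.
rewrite hdotC hdot_suml mulr_sumr; apply: eq_bigr => j _.
by rewrite mulrA hdotC.
Qed.

Lemma psd_gram H (I : finType) (x : I -> H) :
  psd (fun i j => hdot (x i) (x j)).
Proof.
split=> [i j|c]; first exact: hdotC.
by rewrite -norm_sum_sqr sqr_ge0.
Qed.

(** The inequality between the quadratic forms at [c] is the norm bound of [T] at the linear
    combination with coefficients [c]. *)
Lemma loewner_gram H G (T : H -> G) (M : R) (I : finType) (x : I -> H) :
  linear T -> (forall x, `|T x| <= M * `|x|) ->
  loewner (fun i j => hdot (T (x i)) (T (x j)))
          (fun i j => M ^+ 2 * hdot (x i) (x j)).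
Proof.
move=> lT TM; split; first exact: psd_gram.
split=> [i j|c]; first by rewrite hdotC (hdotC (T _)).
rewrite qformD qformN subr_ge0 -norm_sum_sqr.
rewrite -(linear_lincomb _ _ _ _ lT).
have -> : qform (fun i j => M ^+ 2 * hdot (x i) (x j)) c =
    (M * `|\sum_i c i *: x i|) ^+ 2.
  rewrite exprMn norm_sum_sqr /qform mulr_sumr; apply: eq_bigr => i _.
  by rewrite mulr_sumr; apply: eq_bigr => j _; rewrite mulrCA.
by rewrite lerXn2r ?nnegrE // (le_trans _ (TM _)).
Qed.

End hilbert_theory.

Section tensor_product.
Context {R : realType} {d : nat}.

Lemma norm_tens_sum (H : 'I_d -> hilbert R) (HT : hilbert_tensor H)
    (I : finType) (c : I -> R) (f : I -> forall n, H n) :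
  `|\sum_i c i *: tens HT (f i)| ^+ 2 =
  qform (fun i j => \prod_n hdot (f i n) (f j n)) c.
Proof.
rewrite norm_sum_sqr; apply: eq_bigr => i _; apply: eq_bigr => j _.
by rewrite tens_dot.
Qed.

Context (F G : 'I_d -> hilbert R) (FT : hilbert_tensor F) (GT : hilbert_tensor G).
Implicit Type T : forall n, F n -> G n.

(** The Gram matrix of elementary tensors is the entrywise product of the Gram matrices of the
    factors, so the factorwise Loewner inequalities multiply. *)
Lemma norm_tens_image T (M : 'I_d -> R) m (c : 'I_m -> R)
    (f : 'I_m -> forall n, F n) :
  (forall n, linear (T n)) -> (forall n x, `|T n x| <= M n * `|x|) ->
  `|\sum_i c i *: tens GT (fun n => T n (f i n))| ^+ 2 <=
  (\prod_n M n) ^+ 2 * `|\sum_i c i *: tens FT (f i)| ^+ 2.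
Proof.
move=> lT TM; rewrite !norm_tens_sum.
have [_ [_ /(_ c)]] := loewner_prod (fun n =>
  loewner_gram (fun i => f i n) (lT n) (TM n)).
rewrite qformD qformN subr_ge0 => /le_trans; apply.
rewrite le_eqVlt; apply/orP; left; apply/eqP.
rewrite /qform mulr_sumr; apply: eq_bigr => i _.
rewrite mulr_sumr; apply: eq_bigr => j _.
by rewrite big_split /= prodrXl mulrCA.
Qed.

(** Existence of the tensor product operator, which [tensor_op] only selects by its specification,
    together with its norm bound. The estimate on finite sums makes the map well defined there and
    extends it to the closure. *)
Lemma tensor_op_spec T (M : 'I_d -> R) :
  (forall n, bounded_linear (T n)) -> (forall n, 0 <= M n) ->
  (forall n x, `|T n x| <= M n * `|x|) ->
  [/\ bounded_linear (tensor_op FT GT T),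
      forall f, tensor_op FT GT T (tens FT f) = tens GT (fun n => T n (f n)) &
      forall x, `|tensor_op FT GT T x| <= (\prod_n M n) * `|x|].
Proof.
move=> bT M0 TM; have lT n : linear (T n) by case: (bT n).
have PM0 : 0 <= \prod_n M n by rewrite prodr_ge0.
(* A relation and not a function, since one vector has many representations as a sum of elementary
   tensors. *)
pose Gamma x y := exists m (c : 'I_m -> R) (f : 'I_m -> forall n, F n),
  x = \sum_i c i *: tens FT (f i) /\
  y = \sum_i c i *: tens GT (fun n => T n (f i n)).
have [||||W [bW WM WG]] := @dense_extension _ FT GT Gamma (\prod_n M n).
- exact: PM0.
- move=> a x y x' y' [m [c [f [-> ->]]]] [m' [c' [f' [-> ->]]]].
  pose sum_case (X : Type) (u : 'I_m -> X) (v : 'I_m' -> X) i :=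
    match fintype.split i with inl j => u j | inr j => v j end.
  exists (m + m')%N, (sum_case _ (fun i => a * c i) c'), (sum_case _ f f').
  have E (V : lmodType R) (g : (forall n, F n) -> V) :
      a *: (\sum_i c i *: g (f i)) + \sum_i c' i *: g (f' i) =
      \sum_i sum_case _ (fun i => a * c i) c' i *: g (sum_case _ f f' i).
    rewrite big_split_ord /= scaler_sumr; congr (_ + _); apply: eq_bigr => i _.
    - by rewrite /sum_case; case: splitP => j /= ij;
        [rewrite scalerA (_ : j = i) //; exact/val_inj|
         have := ltn_ord i; rewrite ij ltnNge leq_addr].
    - rewrite /sum_case; case: splitP => j /= ij.
        by have := ltn_ord j; rewrite -ij ltnNge leq_addr.
      by rewrite (_ : j = i) //; apply/val_inj; move/addnI: ij.
  by split; [exact: (E _ (tens FT))|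
             exact: (E _ (fun f => tens GT (fun n => T n (f n))))].
- move=> x y [m [c [f [-> ->]]]].
  rewrite -(@ler_pXn2r _ 2) ?nnegrE ?mulr_ge0 // exprMn.
  exact: norm_tens_image.
- apply/denseP => x e e0; have /denseP/(_ x e e0) := @tens_dense _ _ _ FT.
  move=> [a [m [c [f ->]]] xa]; exists (\sum_i c i *: tens FT (f i)) => //.
  by exists (\sum_i c i *: tens GT (fun n => T n (f i n))), m, c, f.
have Wtens f : W (tens FT f) = tens GT (fun n => T n (f n)).
  apply: WG; exists 1%N, (fun=> 1), (fun=> f).
  by rewrite !big_ord1 !scale1r.
(* [W] meets the specification, so the selection in [tensor_lift] does not fall back to the default
   0. *)
have [bL Ltens] : bounded_linear (tensor_op FT GT T) /\ forall f,
    tensor_op FT GT T (tens FT f) = tens GT (fun n => T n (f n)).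
  by rewrite /tensor_op /tensor_lift; case: xgetP => [L -> []//|/(_ W)[]].
suff -> : tensor_op FT GT T = W by split.
apply: (bounded_linear_eq_dense bL bW (@tens_dense _ _ _ FT)).
move=> _ [m [c [f ->]]]; rewrite !linear_lincomb; [|by case: bW|by case: bL].
by apply: eq_bigr => i _; rewrite Ltens Wtens.
Qed.

Lemma tensor_opP T : (forall n, bounded_linear (T n)) ->
  bounded_linear (tensor_op FT GT T) /\
  forall f, tensor_op FT GT T (tens FT f) = tens GT (fun n => T n (f n)).
Proof.
move=> bT; have /choice[M MP] : forall n : 'I_d, exists M : R,
    0 <= M /\ forall x, `|T n x| <= M * `|x|.
  by move=> n; have [M] := bounded_linear_bound (bT n); exists M.
by have [|||] := @tensor_op_spec T M => // n; case: (MP n).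
Qed.

Lemma tensor_op_bounded T : (forall n, bounded_linear (T n)) ->
  bounded_linear (tensor_op FT GT T).
Proof. by case/tensor_opP. Qed.

Lemma tensor_op_tens T f : (forall n, bounded_linear (T n)) ->
  tensor_op FT GT T (tens FT f) = tens GT (fun n => T n (f n)).
Proof. by case/tensor_opP. Qed.

Lemma tensor_op_ext (V : normedModType R) (W W' : FT -> V) :
  bounded_linear W -> bounded_linear W' ->
  (forall f, W (tens FT f) = W' (tens FT f)) -> W = W'.
Proof.
move=> bW bW' WW'.
apply: (bounded_linear_eq_dense bW bW' (@tens_dense _ _ _ FT)).
move=> _ [m [c [f ->]]]; rewrite !linear_lincomb; [|by case: bW'|by case: bW].
by apply: eq_bigr => i _; rewrite WW'.
Qed.

End tensor_product.

(** * Measurability of random operators *)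

Section separable.
Context {R : realType}.
Implicit Types F G H : hilbert R.

Lemma dense_sequence H : exists a : nat -> H,
  forall x e, 0 < e -> exists k, `|x - a k| < e.
Proof.
have [A /countable_injP[g ginj] /denseP dA] := hseparable H.
(* Indices that are not attained by the injection get the default 0. *)
exists (fun k => xget 0 [set x | A x /\ g x = k]) => x e /(dA x)[a Aa xa].
exists (g a); case: xgetP => [y _ [Ay gy]|/(_ a)/not_andP[]//].
by rewrite (ginj y a) ?mem_set.
Qed.

Lemma dense_sequence_ball H : exists b : nat -> H, (forall k, `|b k| <= 1) /\
  forall x e, `|x| <= 1 -> 0 < e -> exists k, `|x - b k| < e.
Proof.
have [a aP] := dense_sequence H.
(* Radial retraction onto the unit ball. For |x| <= 1 < |y| it moves y by |y| - 1 <= |x - y|, hence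
   the e / 2 below. *)
pose p (x : H) := (Num.max 1 `|x|)^-1 *: x.
have p1 x : `|p x| <= 1.
  rewrite /p normrZ gtr0_norm ?invr_gt0 ?lt_max ?ltr01 //.
  by rewrite ler_pdivrMl ?lt_max ?ltr01 // mulr1 le_max lexx orbT.
exists (p \o a); split=> [k|x e x1 e0]; first exact: p1.
have [k xk] := aP x (e / 2) (divr_gt0 e0 (ltr0Sn R 1)).
exists k; rewrite /p /=; set y := a k in xk *.
have [y1|y1] := leP `|y| 1; first by rewrite invr1 scale1r; lra.
have y0 : 0 < `|y| by apply: lt_trans y1.
have -> : x - `|y|^-1 *: y = (x - y) + (1 - `|y|^-1) *: y.
  by rewrite scalerBl scale1r addrA subrK.
apply: (le_lt_trans (ler_normD _ _)); rewrite normrZ ger0_norm; last first.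
  by rewrite subr_ge0 invf_le1 // ltW.
rewrite mulrBl mul1r mulVf ?gt_eqF //.
have : `|y| <= `|x| + `|x - y|.
  have {1}-> : y = x - (x - y) by rewrite subKr.
  exact: ler_normB.
by lra.
Qed.

Lemma bounded_linear_ball_dense F G (T : F -> G) (b : nat -> F) (M : R) :
  bounded_linear T ->
  (forall x e, `|x| <= 1 -> 0 < e -> exists k, `|x - b k| < e) ->
  (forall k, `|T (b k)| <= M) -> forall x, `|x| <= 1 -> `|T x| <= M.
Proof.
move=> bT db TM x x1; have [N N0 TN] := bounded_linear_bound bT.
apply/ler_addgt0Pr => e e0.
have N1 : 0 < N + 1 by rewrite ltr_wpDl.
have [k xk] := db x _ x1 (divr_gt0 e0 N1).
have -> : T x = T (b k) + T (x - b k).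
  by rewrite -(linear_add _ _ (proj1 bT)) addrC subrK.
apply: (le_trans (ler_normD _ _)); apply: lerD => //.
apply: (le_trans (TN _)).
have h4 : (N + 1) * (e / (N + 1)) = e by field; rewrite gt_eqF.
have : N * `|x - b k| <= N * (e / (N + 1)) by rewrite ler_wpM2l // ltW.
have := divr_gt0 e0 N1.
by move: h4; set z := e / _; nra.
Qed.

End separable.

Section measurability.
Context {R : realType} {disp : measure_display} {Omega : measurableType disp}.
Implicit Types F G H : hilbert R.

Lemma measurable_ereal_sup_seq (h : nat -> Omega -> \bar R) :
  (forall k, measurable_fun setT (h k)) ->
  measurable_fun setT (fun w => ereal_sup (range (h ^~ w))).
Proof.
move=> mh; apply: eq_measurable_fun (measurable_fun_esups mh 0) => w _.
by rewrite /esups /sdrop /=; congr ereal_sup; apply/seteqP; split=> x [k _ <-];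
  exists k.
Qed.

Lemma borel_measurable_dist G (X : Omega -> G) a : borel_measurable X ->
  measurable_fun setT (fun w => `|X w - a|).
Proof.
move=> mX; apply: (measurability _ (RGenOInfty.measurableE R)).
move=> _ [_ [r ->] <-].
pose O := [set g : G | r < `|g - a|].
have oO : open O.
  apply: (@open_comp _ _ (fun g : G => `|g - a|) [set x | r < x]); last first.
    exact: open_gt.
  by move=> g _; apply: cvg_norm; apply: cvgB; [exact: cvg_id|exact: cvg_cst].
have := mX measurableT O (sub_sigma_algebra oO).
rewrite !setTI; congr measurable; apply/seteqP.
by split=> w /=; rewrite in_itv /= andbT.
Qed.

(* |x - y| is the supremum of ||x - a| - |y - a|| over a dense sequence.      *)
Lemma borel_measurable_norm_sub G (X Y : Omega -> G) : borel_measurable X ->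
  borel_measurable Y -> measurable_fun setT (fun w => `|X w - Y w|).
Proof.
move=> mX mY; have [a aP] := dense_sequence G.
apply/measurable_EFinP.
pose h k w : \bar R := (`| `|X w - a k| - `|Y w - a k| |)%:E.
apply: (@eq_measurable_fun _ _ _ _ _ (fun w => ereal_sup (range (h ^~ w)))).
  move=> w _; apply/eqP; rewrite eq_le; apply/andP; split.
    apply/ge_ereal_sup => _ [k _ <-]; rewrite /h /= lee_fin.
    apply: (le_trans (ler_dist_dist _ _)); rewrite le_eqVlt; apply/orP; left.
    by apply/eqP; congr `| _ |; rewrite opprB addrA subrK.
  apply/lee_addgt0Pr => e e0 /=.
  have [k Yk] := aP (Y w) (e / 2) (divr_gt0 e0 (ltr0Sn R 1)).
  apply: (@le_trans _ _ (h k w + e%:E)%E); last first.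
    by rewrite leeD2r // ereal_sup_ubound //; exists k.
  rewrite /h -EFinD lee_fin.
  have := ler_norm (`|X w - a k| - `|Y w - a k|).
  have : `|X w - Y w| <= `|X w - a k| + `|Y w - a k|.
    have -> : X w - Y w = (X w - a k) - (Y w - a k).
      by rewrite opprB addrA subrK.
    exact: ler_normB.
  by lra.
apply: measurable_ereal_sup_seq => k; apply/measurable_EFinP.
apply: measurableT_comp; first exact: normr_measurable.
by apply: measurable_funB; exact: borel_measurable_dist.
Qed.

(** Measurability is asked of the norms only: the mean squares depend on nothing else, and by
    polarization the property passes to tensor products. *)
Definition random_operator F G (T : Omega -> F -> G) :=
  (forall w, bounded_linear (T w)) /\
  forall f, measurable_fun setT (fun w => `|T w f|).

Lemma random_operator_norm2 F G (T : Omega -> F -> G) f : random_operator T ->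
  measurable_fun setT (fun w => (`|T w f| ^+ 2)%:E).
Proof.
by move=> [_ mT]; apply/measurable_EFinP; apply: measurable_funX; exact: mT.
Qed.

Lemma random_operator_hdot F G (T : Omega -> F -> G) f g : random_operator T ->
  measurable_fun setT (fun w => hdot (T w f) (T w g)).
Proof.
move=> [bT mT]; under eq_fun => w.
  rewrite hdot_polar -(linear_add _ _ (proj1 (bT w))).
  rewrite -(linear_sub _ _ (proj1 (bT w))).
  over.
apply: measurable_funM => //.
by apply: measurable_funB; apply: measurable_funX; exact: mT.
Qed.

(** By continuity of each [T w] the supremum over the ball equals the supremum over a dense sequence
    of the ball, which is a countable one. *)
Lemma random_operator_ball_sup F G (T : Omega -> F -> G) : random_operator T ->
  measurable_fun setT (fun w => ball_sup (fun f => (`|T w f| ^+ 2)%:E)).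
Proof.
move=> rT; have [b [b1 db]] := dense_sequence_ball F.
pose h k w : \bar R := (`|T w (b k)| ^+ 2)%:E.
apply: (@eq_measurable_fun _ _ _ _ _ (fun w => ereal_sup (range (h ^~ w)))).
  move=> w _; apply/eqP; rewrite eq_le; apply/andP; split.
    apply/ge_ereal_sup => _ [k _ <-]; apply/ereal_sup_ubound.
    by exists (b k) => //=.
  apply/ge_ereal_sup => _ [f /= f1 <-].
  have h0 : (0 <= ereal_sup (range (h ^~ w)))%E.
    apply: (@le_trans _ _ (h 0%N w)); first by rewrite lee_fin sqr_ge0.
    by apply/ereal_sup_ubound; exists 0%N.
  have hk k : (h k w <= ereal_sup (range (h ^~ w)))%E.
    by apply/ereal_sup_ubound; exists k.
  (* For a finite supremum r, sqrt r bounds the norms on the dense sequence and hence on the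
     ball. *)
  case: (ereal_sup _) h0 hk => [r r0 hr|_ _|//]; last by rewrite leey.
  rewrite lee_fin -(sqr_sqrtr r0) ler_pXn2r ?nnegrE ?sqrtr_ge0 //.
  apply: bounded_linear_ball_dense f1 => //; [exact: (proj1 rT)|exact: db|].
  move=> k; have := hr k; rewrite /h lee_fin => /ler_wsqrtr.
  by rewrite sqrtr_sqr normr_id.
by apply: measurable_ereal_sup_seq => k; exact: random_operator_norm2.
Qed.

Lemma random_operator_cst F G (T : F -> G) : bounded_linear T ->
  random_operator (fun _ : Omega => T).
Proof. by move=> bT; split=> // f; exact: measurable_cst. Qed.

End measurability.

(** * Random tensor product operators *)

Section product.
Context {R : realType} {d : nat} {disp : 'I_d -> measure_display}
  {Omega : forall n, measurableType (disp n)}.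

Lemma measurable_coordinate n :
  measurable_fun setT (fun w : product_space Omega => w n).
Proof.
move=> _ A mA; rewrite setTI; apply: sub_sigma_algebra.
by exists n, A.
Qed.

Context {F G : 'I_d -> hilbert R} (FT : hilbert_tensor F) (GT : hilbert_tensor G).
Variable T : forall n, Omega n -> F n -> G n.

Definition tensor_random (w : product_space Omega) : FT -> GT :=
  tensor_op FT GT (fun n => T (w n)).

Hypothesis rT : forall n, random_operator (@T n).

(** On finite sums the squared norm is a combination of products of functions of single coordinates;
    measurability and expectations are both read off from this form. *)
Lemma tensor_random_sum w m (c : 'I_m -> R) (f : 'I_m -> forall n, F n) :
  `|tensor_random w (\sum_i c i *: tens FT (f i))| ^+ 2 =
  qform (fun i j => \prod_n hdot (T (w n) (f i n)) (T (w n) (f j n))) c.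
Proof.
have bT n : bounded_linear (T (w n)) by case: (rT n).
rewrite /tensor_random (linear_lincomb _ _ _ _ (proj1 (tensor_op_bounded FT GT bT))).
rewrite -(norm_tens_sum GT); congr (`| _ | ^+ 2); apply: eq_bigr => i _.
by rewrite tensor_op_tens.
Qed.

Lemma tensor_approx (H : 'I_d -> hilbert R) (HT : hilbert_tensor H) (x : HT) :
  exists (m : nat -> nat) (c : forall k, 'I_(m k) -> R)
    (f : forall k, 'I_(m k) -> forall n, H n),
  (fun k => \sum_i c k i *: tens HT (f k i)) @ \oo --> x.
Proof.
have /denseP dHT := @tens_dense _ _ _ HT.
have /choice[p pP] : forall k : nat, exists p : {m : nat &
    (('I_m -> R) * ('I_m -> forall n, H n))%type},
    `|x - \sum_i (projT2 p).1 i *: tens HT ((projT2 p).2 i)| < k.+1%:R^-1.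
  move=> k; have [|_ [m [c [f ->]]] xy] := dHT x (k.+1%:R^-1).
    by rewrite invr_gt0.
  by exists (existT _ m (c, f)).
exists (fun k => projT1 (p k)), (fun k => (projT2 (p k)).1),
  (fun k => (projT2 (p k)).2).
apply/cvgrPdist_lt => e e0; near=> k; apply: (lt_trans (pP k)).
by near: k; exact: near_infty_natSinv_lt (PosNum e0).
Unshelve. all: by end_near. Qed.

(** Finite sums of elementary tensors are handled by [tensor_random_sum]; for a general vector the
    norm is a pointwise limit of such functions. *)
Lemma random_operator_tensor : random_operator tensor_random.
Proof.
have bT w : bounded_linear (tensor_random w).
  by apply: tensor_op_bounded => n; case: (rT n).
split=> // x; have [m [c [f fx]]] := tensor_approx x.
apply: (@measurable_fun_cvg _ _ _ _
  (fun k w => `|tensor_random w (\sum_i c k i *: tens FT (f k i))|)).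
  move=> k; apply: (@eq_measurable_fun _ _ _ _ _ (fun w : product_space Omega =>
      Num.sqrt (qform (fun i j => \prod_n
        hdot (T (w n) (f k i n)) (T (w n) (f k j n))) (c k)))).
    by move=> w _; rewrite -tensor_random_sum sqrtr_sqr normr_id.
  apply: measurableT_comp.
    by apply: continuous_measurable_fun; exact: sqrt_continuous.
  apply: measurable_sum => i; apply: measurable_sum => j.
  apply: measurable_funM => //; apply: measurable_prod => n _.
  apply: (measurableT_comp (f := fun w => hdot (T w (f k i n)) (T w (f k j n)))).
    exact: random_operator_hdot.
  exact: measurable_coordinate.
move=> w _; apply: cvg_norm; apply: cvg_comp fx _.
by case: (bT w) => _; exact.
Qed.

End product.
Arguments tensor_random {R d disp Omega F G} FT GT T w _.

(** * Integration over the product space *)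

Section integral_factor.
Context {R : realType} {d d' : measure_display} {Omega : measurableType d}
  {Omega' : measurableType d'}.
Variables (P : {measure set Omega -> \bar R}) (Q : {measure set Omega' -> \bar R}).
Variables (p : Omega -> Omega') (h : Omega -> R) (c : R).
Hypotheses (mp : measurable_fun setT p) (mh : measurable_fun setT h).
Hypotheses (h0 : forall w, 0 <= h w) (c0 : 0 <= c).
Hypothesis PQ : forall A, measurable A ->
  (\int[P]_w (\1_A (p w) * h w)%:E = Q A * c%:E)%E.

Import HBNNSimple.

Let mph (f : Omega' -> R) : measurable_fun setT f ->
  measurable_fun setT (fun w => (f (p w) * h w)%:E).
Proof.
move=> mf; apply/measurable_EFinP; apply: measurable_funM => //.
exact: measurableT_comp.
Qed.

(** A simple function is a finite combination of indicators of its level sets, to which [PQ]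
    applies. *)
Let factor_nnsfun (f : {nnsfun Omega' >-> R}) :
  (\int[P]_w (f (p w) * h w)%:E = \int[Q]_x (f x)%:E * c%:E)%E.
Proof.
have fy0 y x : 0 <= y * \1_(f @^-1` [set y]) x.
  by have := nnfun_muleindic_ge0 f y x; rewrite -EFinM lee_fin.
transitivity (\int[P]_w (\sum_(y \in range f)
    (y * \1_(f @^-1` [set y]) (p w) * h w)%:E))%E.
  apply: eq_integral => w _; rewrite EFinM fimfunE -fsumEFin //.
  rewrite !fsbig_finite //= ge0_sume_distrl => [|y _]; last by rewrite lee_fin.
  by apply: eq_bigr => y _; rewrite EFinM.
rewrite ge0_integral_fsum //; last 2 first.
- move=> y; apply: (mph (f := fun x => y * \1_(f @^-1` [set y]) x)).
  exact: measurable_funM.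
- by move=> y w _; rewrite lee_fin mulr_ge0.
under [in RHS]eq_integral do rewrite fimfunE -fsumEFin//.
rewrite ge0_integral_fsum //; last 2 first.
- by move=> y; apply/measurable_EFinP; exact: measurable_funM.
- by move=> y w _; rewrite lee_fin.
rewrite !fsbig_finite //= ge0_sume_distrl => [|y _]; last first.
  by apply: integral_ge0 => x _; rewrite lee_fin.
apply: eq_big_seq => y; rewrite in_fset_set // => /set_mem[x _ xy].
have y0 : 0 <= y by rewrite -xy.
under eq_integral do rewrite -mulrA EFinM.
rewrite ge0_integralZl_EFin //; last 2 first.
- by move=> w _; rewrite lee_fin mulr_ge0.
- by apply: mph.
rewrite PQ //.
under eq_integral do rewrite EFinM.
rewrite ge0_integralZl_EFin ?muleA //; last exact/measurable_EFinP.
by rewrite integral_indic // setIT.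
Qed.

(** One step of Tonelli's theorem for a coordinate [p] and a factor [h] that behaves as independent
    of [p]: monotone convergence carries the identity from simple functions to nonnegative ones. *)
Lemma integral_factor (f : Omega' -> R) : measurable_fun setT f ->
  (forall x, 0 <= f x) ->
  (\int[P]_w (f (p w) * h w)%:E = \int[Q]_x (f x)%:E * c%:E)%E.
Proof.
move=> mf f0; have mF : measurable_fun setT (EFin \o f) by exact/measurable_EFinP.
pose f_ := nnsfun_approx measurableT mF.
have f_f x : (f_ n x)%:E @[n --> \oo] --> (f x)%:E.
  by apply: (cvg_nnsfun_approx measurableT mF) => // y _; rewrite lee_fin.
have ndf x : {homo (fun n => f_ n x) : a b / (a <= b)%N >-> a <= b}.
  by move=> a b ab; exact/lefP/nd_nnsfun_approx.
have cvgQ : (\int[Q]_x (f_ n x)%:E)%E @[n --> \oo] --> (\int[Q]_x (f x)%:E)%E.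
  rewrite (_ : (\int[Q]_x (f x)%:E = \int[Q]_x limn (fun n => (f_ n x)%:E))%E).
    apply: cvg_monotone_convergence => //.
    - by move=> n; exact/measurable_EFinP.
    - by move=> n x _; rewrite lee_fin.
    - by move=> x _ a b ab; rewrite lee_fin; exact: ndf.
  by apply: eq_integral => x _; apply/esym/cvg_lim.
have cvgP : (\int[P]_w (f_ n (p w) * h w)%:E)%E @[n --> \oo] -->
    (\int[P]_w (f (p w) * h w)%:E)%E.
  rewrite (_ : (\int[P]_w (f (p w) * h w)%:E =
      \int[P]_w limn (fun n => (f_ n (p w) * h w)%:E))%E).
    apply: cvg_monotone_convergence => //.
    - by move=> n; exact: mph.
    - by move=> n x _; rewrite lee_fin mulr_ge0.
    - by move=> x _ a b ab; rewrite lee_fin ler_wpM2r //; exact: ndf.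
  apply: eq_integral => w _; apply/esym/cvg_lim => //.
  under eq_fun do rewrite EFinM.
  by rewrite EFinM; apply: cvgeZr.
apply: (cvg_unique _ cvgP) => //.
rewrite (_ : (fun n => _) = fun n => (\int[Q]_x (f_ n x)%:E * c%:E)%E).
  exact: cvgeZr.
by apply/funext => n; exact: factor_nnsfun.
Qed.

End integral_factor.

Section product_integral.
Context {R : realType} {d : nat} {disp : 'I_d -> measure_display}
  {Omega : forall n, measurableType (disp n)}.
Variables (Pn : forall n, probability (Omega n) R)
  (P : probability (product_space Omega) R).
Hypothesis prodP : is_product_probability Pn P.

Lemma measurable_coordinate_comp n (f : Omega n -> R) : measurable_fun setT f ->
  measurable_fun setT (fun w : product_space Omega => f (w n)).
Proof. by move=> mf; apply: measurableT_comp mf _; exact: measurable_coordinate. Qed.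

(* The indicators are replaced by general functions one factor at a time.     *)
Lemma integral_product (f : forall n, Omega n -> R) :
  (forall n, measurable_fun setT (f n)) -> (forall n x, 0 <= f n x) ->
  (forall n, \int[Pn n]_x (f n x)%:E < +oo)%E ->
  (\int[P]_w (\prod_n f n (w n))%:E = \prod_n \int[Pn n]_x (f n x)%:E)%E.
Proof.
(* Induction on k: the factors from k on are still indicators. At k = 0 the claim is the product
   formula for rectangles, at k = d it is the general one. *)
suff H k (g : forall n, Omega n -> R) :
    (forall n, measurable_fun setT (g n)) -> (forall n x, 0 <= g n x) ->
    (forall n, \int[Pn n]_x (g n x)%:E < +oo)%E ->
    (forall n : 'I_d, (k <= n)%N -> exists2 A, measurable A & g n = \1_A) ->
    (\int[P]_w (\prod_n g n (w n))%:E = \prod_n \int[Pn n]_x (g n x)%:E)%E.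
  move=> mf f0 foo; apply: (H d) => // n.
  by rewrite leqNgt ltn_ord.
elim: k g => [|k IH] g mg g0 goo gk.
  pose A n := s2val (cid2 (gk n isT)).
  have AP n : measurable (A n) /\ g n = \1_(A n).
    by rewrite /A; case: (cid2 _).
  transitivity (P [set w | forall n, A n (w n)]).
    rewrite -[X in _ = P X]setIT -integral_indic //; last first.
      rewrite (_ : mkset _ = \bigcap_(n in [set: 'I_d]) [set w | A n (w n)]).
        apply: fin_bigcap_measurable => // n _.
        have := @measurable_coordinate d disp Omega n measurableT _ (proj1 (AP n)).
        by rewrite setTI.
      by apply/seteqP; split=> [w /= h n _|w /= h n]; exact: h.
    apply: eq_integral => w _; congr EFin; rewrite indicE.
    case: (pselect (forall n, A n (w n))) => Aw.
      rewrite mem_set // big1 // => n _.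
      by rewrite (proj2 (AP n)) indicE mem_set.
    rewrite memNset //; move/existsNP: Aw => [n Anw].
    by rewrite (bigD1 n) //= (proj2 (AP n)) indicE memNset // mul0r.
  rewrite prodP => [|n]; last exact: (proj1 (AP n)).
  apply: eq_bigr => n _; rewrite (proj2 (AP n)) integral_indic ?setIT //.
  exact: (proj1 (AP n)).
have [kd|dk] := ltnP k d; last first.
  apply: IH => // n kn; have := ltn_ord n.
  by move/(leq_ltn_trans (leq_trans dk kn)); rewrite ltnn.
pose n0 := Ordinal kd.
have fin n : (\int[Pn n]_x (g n x)%:E)%E \is a fin_num.
  by rewrite ge0_fin_numE //; apply: integral_ge0 => x _; rewrite lee_fin.
pose c := \prod_(n | n != n0) fine (\int[Pn n]_x (g n x)%:E)%E.
have cE : (c%:E = \prod_(n | n != n0) \int[Pn n]_x (g n x)%:E)%E.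
  rewrite /c -prodEFin; apply: eq_bigr => n _; rewrite fineK //.
rewrite (bigD1 n0) //= -cE.
under eq_integral do rewrite (bigD1 n0) //=.
apply: (@integral_factor _ _ _ _ _ _ _ (fun w : product_space Omega => w n0)
  (fun w => \prod_(n | n != n0) g n (w n))) => //.
- exact: measurable_coordinate.
- apply: (@eq_measurable_fun _ _ _ _ _ (fun w : product_space Omega =>
    \prod_(n <- [seq n <- index_enum 'I_d | n != n0]) g n (w n))).
    by move=> w _; rewrite big_filter.
  by apply: measurable_prod => n _; exact: measurable_coordinate_comp.
- by move=> w; rewrite prodr_ge0.
(* Replacing factor k by an arbitrary indicator gives a product covered by the induction hypothesis;
   this is the premise of [integral_factor]. *)
move=> A mA; pose g' := dfwith g n0 (\1_A : Omega n0 -> R).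
have g'n n : n != n0 -> g' n = g n by rewrite eq_sym => ?; rewrite /g' dfwithout.
have g'0 : g' n0 = \1_A by rewrite /g' dfwithin.
transitivity (\int[P]_w (\prod_n g' n (w n))%:E)%E.
  apply: eq_integral => w _; rewrite [in RHS](bigD1 n0) //= g'0.
  by congr (_ * _)%:E; apply: eq_bigr => n /g'n ->.
rewrite IH.
- rewrite (bigD1 n0) //= g'0 integral_indic // setIT cE.
  by congr (_ * _)%E; apply: eq_bigr => n /g'n ->.
- by move=> n; have [->|/g'n ->//] := eqVneq n n0; rewrite g'0.
- move=> n; have [->|/g'n -> x] := eqVneq n n0; last exact: g0.
  by move=> x; rewrite g'0.
- move=> n; have [->|/g'n ->//] := eqVneq n n0.
  by rewrite g'0 integral_indic // setIT (le_lt_trans (probability_le1 _ _)) ?ltry.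
- move=> n kn; have [->|nn0] := eqVneq n n0; first by exists A.
  rewrite g'n //; apply: gk; rewrite ltn_neqAle kn andbT.
  by apply: contra nn0 => /eqP kE; apply/eqP/val_inj.
Qed.

End product_integral.

(** * Monotonicity of the integral and means of signed functions *)

Section integral_calculus.
Context {R : realType} {disp : measure_display} {Omega : measurableType disp}.
Variable P : probability Omega R.

(** The integral of a nonnegative function is the supremum over the simple functions below it, which
    is monotone without measurability; this matters for the number of functionals, which is not
    known to be measurable. *)
Lemma le_integral_nonneg (f g : Omega -> \bar R) : (forall w, 0 <= f w)%E ->
  (forall w, f w <= g w)%E -> (\int[P]_w f w <= \int[P]_w g w)%E.
Proof.
move=> f0 fg; have g0 w : (0 <= g w)%E by exact: le_trans (f0 w) (fg w).
rewrite !ge0_integralTE //; apply: le_ereal_sup => _ [h /= hf <-].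
by exists h => // w; exact: le_trans (hf w) (fg w).
Qed.

Definition has_mean (f : Omega -> R) (r : R) :=
  P.-integrable setT (EFin \o f) /\ (\int[P]_w (f w)%:E = r%:E)%E.

Lemma has_mean_ge0 (f : Omega -> R) : measurable_fun setT f ->
  (forall w, 0 <= f w) -> (\int[P]_w (f w)%:E < +oo)%E ->
  has_mean f (fine (\int[P]_w (f w)%:E)%E).
Proof.
move=> mf f0 foo; have I0 : (0 <= \int[P]_w (f w)%:E)%E.
  by apply: integral_ge0 => w _; rewrite lee_fin.
split; last by rewrite fineK // ge0_fin_numE.
apply/integrableP; split; first exact/measurable_EFinP.
by under eq_integral do rewrite /= ger0_norm //.
Qed.

Lemma has_meanZ (c : R) f r : has_mean f r ->
  has_mean (fun w => c * f w) (c * r).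
Proof.
move=> [If fr]; split.
  apply: eq_integrable (integrableZl measurableT c If) => //.
under eq_integral do rewrite EFinM.
by rewrite integralZl // fr EFinM.
Qed.

Lemma has_meanB f g r s : has_mean f r -> has_mean g s ->
  has_mean (fun w => f w - g w) (r - s).
Proof.
move=> [If fr] [Ig gs]; split.
  by apply: eq_integrable (integrableB measurableT If Ig).
by under eq_integral do rewrite EFinB; rewrite integralB // fr gs.
Qed.

Lemma has_mean_sum (I : finType) (f : I -> Omega -> R) (r : I -> R) :
  (forall i, has_mean (f i) (r i)) ->
  has_mean (fun w => \sum_i f i w) (\sum_i r i).
Proof.
move=> fr; split.
  apply: (eq_integrable measurableT (fun w => (\sum_i (f i w)%:E)%E)).
    by move=> w _; rewrite /= -sumEFin.
  by apply: integrable_sum => // i _; case: (fr i).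
under eq_integral do rewrite -sumEFin.
rewrite integral_sum //; last by move=> i; case: (fr i).
by rewrite -sumEFin; apply: eq_bigr => i _; case: (fr i).
Qed.

End integral_calculus.

Section signed_product.
Context {R : realType} {d : nat} {disp : 'I_d -> measure_display}
  {Omega : forall n, measurableType (disp n)}.
Variables (Pn : forall n, probability (Omega n) R)
  (P : probability (product_space Omega) R).
Hypothesis prodP : is_product_probability Pn P.

(** Expanding the product of differences into 2^d signed products of nonnegative functions reduces
    the claim to [integral_product]. Inner products enter in this form through polarization. *)
Lemma has_mean_product (a b : forall n, Omega n -> R) (r s : 'I_d -> R) :
  (forall n x, 0 <= a n x) -> (forall n x, 0 <= b n x) ->
  (forall n, has_mean (Pn n) (a n) (r n)) ->
  (forall n, has_mean (Pn n) (b n) (s n)) ->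
  has_mean P (fun w => \prod_n (a n (w n) - b n (w n))) (\prod_n (r n - s n)).
Proof.
move=> a0 b0 ar bs.
have expand (u v : 'I_d -> R) : \prod_n (u n - v n) =
    \sum_(phi : {ffun 'I_d -> bool}) (\prod_n (-1) ^+ phi n) *
      \prod_n (if phi n then v n else u n).
  transitivity (\prod_n \sum_(e : bool) (-1) ^+ e * (if e then v n else u n)).
    by apply: eq_bigr => n _; rewrite big_bool /= expr1 expr0 mul1r mulN1r addrC.
  rewrite bigA_distr_bigA; apply: eq_bigr => phi _.
  by rewrite -big_split.
rewrite (expand r s).
under [X in has_mean P X _]eq_fun do rewrite expand.
apply: has_mean_sum => phi; apply: has_meanZ.
pose c n x := if phi n then b n x else a n x.
have c0 n x : 0 <= c n x by rewrite /c; case: (phi n).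
have ct n : has_mean (Pn n) (c n) (if phi n then s n else r n).
  by rewrite /c; case: (phi n).
have mc n : measurable_fun setT (c n).
  by have [/integrableP[/measurable_EFinP]] := ct n.
have E : (\int[P]_w (\prod_n c n (w n))%:E =
    (\prod_n (if phi n then s n else r n))%:E)%E.
  rewrite (integral_product prodP) // => [|n].
    by rewrite -prodEFin; apply: eq_bigr => n _; case: (ct n).
  by case: (ct n) => _ ->; rewrite ltry.
have -> : \prod_n (if phi n then s n else r n) =
    fine (\int[P]_w (\prod_n c n (w n))%:E)%E by rewrite E.
apply: has_mean_ge0.
- by apply: measurable_prod => n _; exact: (measurable_coordinate_comp (mc n)).
- by move=> w; apply: prodr_ge0 => n _; exact: c0.
- by rewrite E ltry.
Qed.

End signed_product.

(** * Mean squares of sums and of tensor products *)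

Section mean_square_sum.
Context {R : realType} {disp : measure_display} {Omega : measurableType disp}.
Variable P : probability Omega R.

(* With t i a bound on the mean square of a i, integrating gives Minkowski's   *)
(* inequality (mean square of the sum at most the sum of the t i).            *)
Lemma sqr_sum_le (I : Type) (r : seq I) (Q : pred I) (a t : I -> R) :
  (forall i, Q i -> 0 < t i) ->
  (\sum_(i <- r | Q i) a i) ^+ 2 <=
  (\sum_(i <- r | Q i) t i) * \sum_(i <- r | Q i) (t i)^-1 * a i ^+ 2.
Proof.
move=> t0; elim: r => [|i r IH]; first by rewrite !big_nil mul0r expr0n.
rewrite !big_cons; case: ifP => // Qi.
set A := \sum_(_ <- _ | _) _ in IH *; set T := \sum_(_ <- _ | _) _ in IH *.
set S := \sum_(_ <- _ | _) _ in IH *.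
have T0 : 0 <= T by apply: sumr_ge0 => j /t0/ltW.
have S0 : 0 <= S.
  by apply: sumr_ge0 => j /t0 tj; rewrite mulr_ge0 ?sqr_ge0 // invr_ge0 ltW.
(* Since x y = a_i^2 T S >= (a_i A)^2 by induction, the arithmetic-geometric mean inequality bounds
   the cross term 2 a_i A by x + y. *)
have ti := t0 _ Qi; pose x := t i * S; pose y := T * ((t i)^-1 * a i ^+ 2).
have x0 : 0 <= x by rewrite mulr_ge0 // ltW.
have y0 : 0 <= y.
  by rewrite mulr_ge0 // mulr_ge0 ?sqr_ge0 // invr_ge0 ltW.
have -> : (t i + T) * ((t i)^-1 * a i ^+ 2 + S) = a i ^+ 2 + x + y + T * S.
  by rewrite /x /y; field; rewrite gt_eqF.
have xy : x * y = a i ^+ 2 * (T * S) by rewrite /x /y; field; rewrite gt_eqF.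
have : 2 * (a i * A) <= x + y.
  have : (2 * (a i * A)) ^+ 2 <= (x + y) ^+ 2.
    have : a i ^+ 2 * A ^+ 2 <= x * y by rewrite xy ler_wpM2l ?sqr_ge0.
    by have := sqr_ge0 (x - y); rewrite !expr2; lra.
  by rewrite -ler_sqrt ?sqr_ge0 // !sqrtr_sqr (ger0_norm (addr_ge0 x0 y0));
    apply: le_trans; exact: ler_norm.
by move: IH; rewrite !expr2; lra.
Qed.

Lemma sqrte_le (x : \bar R) (t : R) : 0 <= t ->
  (sqrte x <= t%:E)%E = (x <= (t ^+ 2)%:E)%E.
Proof.
move=> t0; rewrite -(lee_sqrt x) ?lee_fin ?sqr_ge0 //.
by rewrite /= sqrtr_sqr ger0_norm.
Qed.

Lemma ball_sup_ge0 (F : normedModType R) (u : F -> \bar R) :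
  (forall f, 0 <= u f)%E -> (0 <= ball_sup u)%E.
Proof.
move=> u0; apply: (le_trans (u0 0)); apply: ereal_sup_ubound.
by exists 0 => //=; rewrite normr0.
Qed.

Lemma ball_sup_ub (F : normedModType R) (u : F -> \bar R) f :
  `|f| <= 1 -> (u f <= ball_sup u)%E.
Proof. by move=> f1; apply: ereal_sup_ubound; exists f. Qed.

Lemma ball_sup_leP (F : normedModType R) (u : F -> \bar R) M :
  (ball_sup u <= M)%E <-> forall f, `|f| <= 1 -> (u f <= M)%E.
Proof.
split=> [uM f f1|uM]; first exact: le_trans (ball_sup_ub _ f1) uM.
by apply/ge_ereal_sup => _ [f /= f1 <-]; exact: uM.
Qed.

Lemma mean_square_randomizedP (F G : normedModType R) (T : Omega -> F -> G) t :
  0 <= t -> (mean_square Randomized P T <= t%:E)%E <->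
  forall f, `|f| <= 1 -> (\int[P]_w (`|T w f| ^+ 2)%:E <= (t ^+ 2)%:E)%E.
Proof.
move=> t0; rewrite /mean_square; split=> [/ball_sup_leP h f /h|h].
  by rewrite sqrte_le.
by apply/ball_sup_leP => f /h; rewrite sqrte_le.
Qed.

Lemma mean_square_worst_caseP (F G : normedModType R) (T : Omega -> F -> G) t :
  0 <= t -> (mean_square WorstCase P T <= t%:E)%E <->
  (\int[P]_w ball_sup (fun f => (`|T w f| ^+ 2)%:E) <= (t ^+ 2)%:E)%E.
Proof. by move=> t0; rewrite /mean_square sqrte_le. Qed.

(** After integration the summand with weight 1 / t_i is at most t_i, so the sum is at most sum t_i,
    once more multiplied by sum t_i. *)
Lemma integral_weighted_sum (I : eqType) (r : seq I) (t : I -> R)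
    (g : I -> Omega -> \bar R) (G : Omega -> \bar R) :
  (forall i, 0 < t i) -> (forall i w, 0 <= g i w)%E ->
  (forall i, measurable_fun setT (g i)) ->
  (forall i, i \in r -> \int[P]_w g i w <= (t i ^+ 2)%:E)%E ->
  (forall w, 0 <= G w)%E ->
  (forall w, G w <= (\sum_(i <- r) t i)%:E * \sum_(i <- r) (t i)^-1%:E * g i w)%E ->
  (\int[P]_w G w <= ((\sum_(i <- r) t i) ^+ 2)%:E)%E.
Proof.
move=> t0 g0 mg gt G0 Gg.
have ti0 i : (0 <= (t i)^-1%:E)%E by rewrite lee_fin invr_ge0 ltW.
have T0 : 0 <= \sum_(i <- r) t i by apply: sumr_ge0 => i _; exact: ltW.
have mtg i : measurable_fun setT (fun w => (t i)^-1%:E * g i w)%E.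
  exact: measurable_funeM.
apply: (le_trans (le_integral_nonneg _ G0 Gg)).
rewrite ge0_integralZl_EFin //; last 2 first.
- by move=> w _; apply: sume_ge0 => i _; exact: mule_ge0.
- exact: emeasurable_sum.
rewrite ge0_integral_sum //; last by move=> i w _; exact: mule_ge0.
rewrite expr2 EFinM; apply: lee_wpmul2l; first by rewrite lee_fin.
rewrite -sumEFin big_seq [leRHS]big_seq; apply: lee_sum => i ir.
rewrite ge0_integralZl_EFin //; last by rewrite invr_ge0 ltW.
apply: (le_trans (lee_wpmul2l (ti0 i) (gt i ir))).
by rewrite -EFinM lee_fin expr2 mulrA mulVf ?mul1r // gt_eqF.
Qed.

(** The triangle inequality for both criteria: [sqr_sum_le] holds pointwise for each [f] and
    survives the supremum over the ball. *)
Lemma mean_square_sum x (F G : hilbert R) (I : eqType) (r : seq I) (t : I -> R)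
    (T : I -> Omega -> F -> G) :
  (forall i, 0 < t i) -> (forall i, random_operator (T i)) ->
  (forall i, i \in r -> mean_square x P (T i) <= (t i)%:E)%E ->
  (mean_square x P (fun w => \sum_(i <- r) T i w)%R <= (\sum_(i <- r) t i)%:E)%E.
Proof.
move=> t0 rT Tt.
have ti0 i : 0 <= (t i)^-1 by rewrite invr_ge0 ltW.
have T0 : 0 <= \sum_(i <- r) t i by apply: sumr_ge0 => i _; exact: ltW.
have pointwise w f : `|(\sum_(i <- r) T i w) f| ^+ 2 <=
    (\sum_(i <- r) t i) * \sum_(i <- r) (t i)^-1 * `|T i w f| ^+ 2.
  apply: (le_trans _ (sqr_sum_le r (fun i => `|T i w f|) (fun i _ => t0 i))).
  rewrite lerXn2r ?nnegrE ?sumr_ge0 //.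
  by rewrite fct_sumE; exact: ler_norm_sum.
case: x Tt => Tt.
  apply/mean_square_randomizedP => // f f1.
  apply: (@integral_weighted_sum _ _ _ (fun i w => (`|T i w f| ^+ 2)%:E)) => //.
  - by move=> i; exact: random_operator_norm2.
  - by move=> i /Tt /mean_square_randomizedP; apply => //; exact: ltW.
  - move=> w; have := pointwise w f; rewrite -lee_fin => /le_trans; apply.
    rewrite EFinM; apply: lee_wpmul2l; first by rewrite lee_fin.
    by rewrite -sumEFin; apply: lee_sum => i _; rewrite EFinM.
apply/mean_square_worst_caseP => //.
apply: (@integral_weighted_sum _ _ _
    (fun i w => ball_sup (fun f => (`|T i w f| ^+ 2)%:E))) => //.
- by move=> i w; apply: ball_sup_ge0 => f; rewrite lee_fin sqr_ge0.
- by move=> i; exact: random_operator_ball_sup.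
- by move=> i /Tt /mean_square_worst_caseP; apply; exact: ltW.
- by move=> w; apply: ball_sup_ge0 => f; rewrite lee_fin sqr_ge0.
move=> w; apply/ball_sup_leP => f f1.
apply: (@le_trans _ _ (((\sum_(i <- r) t i) *
    \sum_(i <- r) (t i)^-1 * `|T i w f| ^+ 2)%:E)); first by rewrite lee_fin.
rewrite EFinM; apply: lee_wpmul2l; first by rewrite lee_fin.
rewrite -sumEFin; apply: lee_sum => i _; rewrite EFinM.
apply: lee_wpmul2l; first by rewrite lee_fin.
exact: (ball_sup_ub (fun f => (`|T i w f| ^+ 2)%:E)).
Qed.

End mean_square_sum.

Section operator_ball.
Context {R : realType}.

Lemma linear_unit_ball (F G : normedModType R) (T : F -> G) M : linear T ->
  (forall f, `|f| <= 1 -> `|T f| <= M) -> forall f, `|T f| <= M * `|f|.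
Proof.
move=> lT TM f; have [->|f0] := eqVneq f 0.
  by rewrite (linear_zero lT) !normr0 mulr0.
have nf : 0 < `|f| by rewrite normr_gt0.
have := TM (`|f|^-1 *: f); rewrite (linear_scale _ _ lT) (normrZ _ f).
rewrite (normrZ _ (T f)) normfV normr_id mulVf ?gt_eqF // => /(_ (lexx _)).
by rewrite ler_pdivrMl // mulrC.
Qed.

Lemma ball_sup_sqr_fin (F G : normedModType R) (T : F -> G) :
  bounded_linear T -> (ball_sup (fun f => (`|T f| ^+ 2)%:E) \is a fin_num)%E.
Proof.
move=> /bounded_linear_bound[M M0 TM]; rewrite ge0_fin_numE; last first.
  by apply: ball_sup_ge0 => f; rewrite lee_fin sqr_ge0.
apply: (@le_lt_trans _ _ (M ^+ 2)%:E); last exact: ltry.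
apply/ball_sup_leP => f f1; rewrite lee_fin lerXn2r ?nnegrE //.
by apply: (le_trans (TM f)); rewrite ler_piMr.
Qed.

Lemma ball_sup_sqr_norm (F G : normedModType R) (T : F -> G) f :
  bounded_linear T -> `|T f| <=
    Num.sqrt (fine (ball_sup (fun f => (`|T f| ^+ 2)%:E))) * `|f|.
Proof.
move=> bT; apply: linear_unit_ball f; first by case: bT.
move=> f f1; rewrite -[leLHS]normr_id -sqrtr_sqr; apply: ler_wsqrtr.
rewrite -lee_fin fineK ?ball_sup_sqr_fin //.
exact: (ball_sup_ub (fun f => (`|T f| ^+ 2)%:E)).
Qed.

End operator_ball.

(** * Tensor products of independent random operators *)

Section tensor_mean_square.
Context {R : realType} {d : nat} {disp : 'I_d -> measure_display}
  {Omega : forall n, measurableType (disp n)}.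
Variables (Pn : forall n, probability (Omega n) R)
  (P : probability (product_space Omega) R).
Hypothesis prodP : is_product_probability Pn P.
Context {F G : 'I_d -> hilbert R} (FT : hilbert_tensor F) (GT : hilbert_tensor G).
Variables (T : forall n, Omega n -> F n -> G n) (t : 'I_d -> R).
Hypotheses (rT : forall n, random_operator (@T n)) (t0 : forall n, 0 <= t n).

(** For every outcome the norm of the tensor product is at most the product of the norms; their
    squares depend on separate coordinates, so the expectation factorizes. *)
Lemma worst_case_tensor :
  (forall n, mean_square WorstCase (Pn n) (@T n) <= (t n)%:E)%E ->
  (mean_square WorstCase P (tensor_random FT GT T) <= (\prod_n t n)%:E)%E.
Proof.
move=> Tt; apply/mean_square_worst_caseP; first by rewrite prodr_ge0.
pose b n (w : Omega n) := ball_sup (fun f => (`|T w f| ^+ 2)%:E) : \bar R.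
pose B n (w : Omega n) := fine (b n w).
have bB n w : b n w = (B n w)%:E.
  by rewrite /B fineK // ball_sup_sqr_fin //; case: (rT n).
have B0 n w : 0 <= B n w.
  by rewrite -lee_fin -bB; apply: ball_sup_ge0 => f; rewrite lee_fin sqr_ge0.
have Bt n : (\int[Pn n]_w (B n w)%:E <= (t n ^+ 2)%:E)%E.
  under eq_integral do rewrite -bB.
  by have /mean_square_worst_caseP := Tt n; exact.
have mB n : measurable_fun setT (B n).
  apply/measurable_EFinP; apply: eq_measurable_fun (random_operator_ball_sup (rT n)).
  by move=> w _; rewrite /= -bB.
apply: (@le_trans _ _ (\int[P]_w (\prod_n B n (w n))%:E)%E).
  apply: le_integral_nonneg => w.
    by apply: ball_sup_ge0 => f; rewrite lee_fin sqr_ge0.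
  apply/ball_sup_leP => f f1; rewrite lee_fin.
  have bT n : bounded_linear (T (w n)) by case: (rT n).
  have [|||_ _ h] := @tensor_op_spec _ _ _ _ FT GT (fun n => T (w n))
    (fun n => Num.sqrt (B n (w n))) => //.
    by move=> n x; exact: ball_sup_sqr_norm.
  have -> : \prod_n B n (w n) = (\prod_n Num.sqrt (B n (w n))) ^+ 2.
    by rewrite -prodrXl; apply: eq_bigr => n _; rewrite sqr_sqrtr.
  rewrite lerXn2r ?nnegrE ?prodr_ge0 //.
  apply: (le_trans (h f)); rewrite ler_piMr // prodr_ge0 //.
rewrite (integral_product prodP) //; last first.
  by move=> n; apply: (le_lt_trans (Bt n)); exact: ltry.
rewrite -prodrXl; pose r n := fine (\int[Pn n]_w (B n w)%:E)%E.
have I0 n : (0 <= \int[Pn n]_w (B n w)%:E)%E.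
  by apply: integral_ge0 => w _; rewrite lee_fin.
have rE n : (\int[Pn n]_w (B n w)%:E = (r n)%:E)%E.
  by rewrite fineK // ge0_fin_numE // (le_lt_trans (Bt n)) ?ltry.
rewrite (eq_bigr (fun n => (r n)%:E) (fun n _ => rE n)).
rewrite prodEFin lee_fin; apply: ler_prod => n _.
by rewrite -!lee_fin -rE I0 Bt.
Qed.

Section randomized.
Hypothesis Tt : forall n, (mean_square Randomized (Pn n) (@T n) <= (t n)%:E)%E.

Lemma randomized_second_moment n f :
  (\int[Pn n]_w (`|T w f| ^+ 2)%:E <= (t n ^+ 2 * `|f| ^+ 2)%:E)%E.
Proof.
have lT (w : Omega n) : linear (T w) by case: (rT n) => /(_ w)[].
have [->|f0] := eqVneq f 0.
  under eq_integral do rewrite (linear_zero (lT _)) normr0 expr0n.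
  by rewrite integral0 normr0 expr0n mulr0.
have nf : 0 < `|f| by rewrite normr_gt0.
have /mean_square_randomizedP/(_ (`|f|^-1 *: f)) := Tt n.
move=> /(_ (t0 n)); rewrite normrZ normfV normr_id.
rewrite mulVf ?gt_eqF // => /(_ (lexx _)).
under eq_integral.
  move=> w _; rewrite (linear_scale _ _ (lT w)) normrZ normfV normr_id.
  rewrite exprMn EFinM; over.
rewrite ge0_integralZl_EFin ?sqr_ge0 //; last first.
  exact: random_operator_norm2.
rewrite exprVn lee_pdivrMl ?exprn_gt0 // -EFinM mulrC.
exact.
Qed.

Let has_mean_quarter n f :
  has_mean (Pn n) (fun w : Omega n => 4^-1 * `|T w f| ^+ 2)
    (4^-1 * fine (\int[Pn n]_w (`|T w f| ^+ 2)%:E)%E).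
Proof.
apply: has_meanZ; apply: has_mean_ge0.
- by apply: measurable_funX; case: (rT n).
- by move=> w; exact: sqr_ge0.
- by apply: le_lt_trans (randomized_second_moment f) _; exact: ltry.
Qed.

(* [E <T f, T g>], by polarization. *)
Definition mean_dot n (f g : F n) : R :=
  4^-1 * fine (\int[Pn n]_w (`|T w (f + g)| ^+ 2)%:E)%E -
  4^-1 * fine (\int[Pn n]_w (`|T w (f - g)| ^+ 2)%:E)%E.

Lemma hdot_image n (w : Omega n) f g : hdot (T w f) (T w g) =
  4^-1 * `|T w (f + g)| ^+ 2 - 4^-1 * `|T w (f - g)| ^+ 2.
Proof.
have lT : linear (T w) by case: (rT n) => /(_ w)[].
rewrite hdot_polar -(linear_add _ _ lT) -(linear_sub _ _ lT).
by rewrite mulrC mulrBr.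
Qed.

(** By independence, the expected Gram matrix of the images of elementary tensors is the entrywise
    product of the expected Gram matrices of the factors. *)
Lemma has_mean_tensor m (c : 'I_m -> R) (f : 'I_m -> forall n, F n) :
  has_mean P (fun w => `|tensor_random FT GT T w (\sum_i c i *: tens FT (f i))| ^+ 2)
    (qform (fun i j => \prod_n mean_dot (f i n) (f j n)) c).
Proof.
rewrite (_ : (fun w => _) = fun w : product_space Omega => \sum_i \sum_j c i * c j *
    \prod_n (4^-1 * `|T (w n) (f i n + f j n)| ^+ 2 -
             4^-1 * `|T (w n) (f i n - f j n)| ^+ 2)); last first.
  apply/funext => w; rewrite tensor_random_sum //; apply: eq_bigr => i _.
  by apply: eq_bigr => j _; congr (_ * _); apply: eq_bigr => n _; exact: hdot_image.
apply: has_mean_sum => i; apply: has_mean_sum => j; apply: has_meanZ.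
apply: (has_mean_product prodP
    (a := fun n w => 4^-1 * `|T w (f i n + f j n)| ^+ 2)
    (b := fun n w => 4^-1 * `|T w (f i n - f j n)| ^+ 2)) => n;
  [| |exact: has_mean_quarter..].
- by move=> w; rewrite mulr_ge0 ?invr_ge0 ?sqr_ge0.
- by move=> w; rewrite mulr_ge0 ?invr_ge0 ?sqr_ge0.
Qed.

Lemma has_mean_image_sum n m (c : 'I_m -> R) (f : 'I_m -> F n) :
  has_mean (Pn n) (fun w => `|T w (\sum_i c i *: f i)| ^+ 2)
    (qform (fun i j => mean_dot (f i) (f j)) c).
Proof.
rewrite (_ : (fun w => _) = fun w : Omega n => \sum_i \sum_j c i * c j *
    (4^-1 * `|T w (f i + f j)| ^+ 2 - 4^-1 * `|T w (f i - f j)| ^+ 2)).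
  apply: has_mean_sum => i; apply: has_mean_sum => j; apply: has_meanZ.
  by apply: has_meanB; exact: has_mean_quarter.
apply/funext => w; have lT : linear (T w) by case: (rT n) => /(_ w)[].
rewrite (linear_lincomb _ _ _ _ lT) norm_sum_sqr; apply: eq_bigr => i _.
by apply: eq_bigr => j _; congr (_ * _); exact: hdot_image.
Qed.

(** Both quadratic forms are second moments: that of the image of a linear combination, and its
    upper bound. *)
Lemma loewner_mean_dot n m (f : 'I_m -> F n) :
  loewner (fun i j => mean_dot (f i) (f j))
          (fun i j => t n ^+ 2 * hdot (f i) (f j)).
Proof.
have sym i j : mean_dot (f i) (f j) = mean_dot (f j) (f i).
  rewrite /mean_dot [f j + _]addrC; congr (_ - 4^-1 * fine _).
  apply: eq_integral => w _; have lT : linear (T w) by case: (rT n) => /(_ w)[].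
  by rewrite -opprB -scaleN1r (linear_scale _ _ lT) scaleN1r normrN.
split; split=> [i j|c]; first exact: sym.
- rewrite -lee_fin; have [_ <-] := has_mean_image_sum c f.
  by apply: integral_ge0 => w _; rewrite lee_fin sqr_ge0.
- by rewrite sym hdotC.
rewrite qformD qformN subr_ge0 -lee_fin.
have [_ <-] := has_mean_image_sum c f.
apply: (le_trans (randomized_second_moment _)).
rewrite lee_fin norm_sum_sqr /qform mulr_sumr le_eqVlt; apply/orP; left.
apply/eqP; apply: eq_bigr => i _; rewrite mulr_sumr; apply: eq_bigr => j _.
by rewrite mulrCA.
Qed.

Lemma randomized_tensor_sum m (c : 'I_m -> R) (f : 'I_m -> forall n, F n) :
  (\int[P]_w (`|tensor_random FT GT T w (\sum_i c i *: tens FT (f i))| ^+ 2)%:E <=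
   ((\prod_n t n) ^+ 2 * `|\sum_i c i *: tens FT (f i)| ^+ 2)%:E)%E.
Proof.
have [_ ->] := has_mean_tensor c f; rewrite lee_fin norm_tens_sum.
have [_ [_ /(_ c)]] := loewner_prod (fun n => loewner_mean_dot (fun i => f i n)).
rewrite qformD qformN subr_ge0 => /le_trans; apply.
rewrite le_eqVlt; apply/orP; left; apply/eqP.
rewrite /qform mulr_sumr; apply: eq_bigr => i _.
rewrite mulr_sumr; apply: eq_bigr => j _.
by rewrite big_split /= prodrXl mulrCA.
Qed.

(** The bound holds on finite sums by Schur's theorem. These approximate [x], every outcome is a
    continuous operator, and Fatou's lemma transfers the bound to the limit. *)
Lemma randomized_tensor :
  (mean_square Randomized P (tensor_random FT GT T) <= (\prod_n t n)%:E)%E.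
Proof.
have PT0 : 0 <= \prod_n t n by rewrite prodr_ge0.
have rTT := random_operator_tensor FT GT rT.
apply/mean_square_randomizedP => // x x1; have [m [c [f fx]]] := tensor_approx x.
pose y k := \sum_i c k i *: tens FT (f k i).
have yx : y k @[k --> \oo] --> x by [].
pose u k w : \bar R := (`|tensor_random FT GT T w (y k)| ^+ 2)%:E.
have ux w : u k w @[k --> \oo] --> (`|tensor_random FT GT T w x| ^+ 2)%:E.
  apply: cvg_EFin; first exact: nearW.
  rewrite (_ : fine \o _ = fun k => `|tensor_random FT GT T w (y k)| ^+ 2) //.
  have : `|tensor_random FT GT T w (y k)| @[k --> \oo] --> `|tensor_random FT GT T w x|.
    apply: cvg_norm; apply: cvg_comp yx _.
    by case: rTT => /(_ w)[_ cT] _; exact: cT.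
  by rewrite !expr2 => h; under eq_fun do rewrite expr2; exact: cvgM.
have bx : ((\prod_n t n) ^+ 2 * `|y k| ^+ 2)%:E @[k --> \oo] -->
    ((\prod_n t n) ^+ 2 * `|x| ^+ 2)%:E.
  apply: cvg_EFin; first exact: nearW.
  rewrite (_ : fine \o _ = fun k => (\prod_n t n) ^+ 2 * `|y k| ^+ 2) //.
  apply: cvgMr; have h : `|y k| @[k --> \oo] --> `|x| by exact: (cvg_norm yx).
  by rewrite expr2; under eq_fun do rewrite expr2; exact: cvgM.
apply: (@le_trans _ _ ((\prod_n t n) ^+ 2 * `|x| ^+ 2)%:E); last first.
  by rewrite lee_fin ler_piMr ?sqr_ge0 // expr_le1.
(* The integrand is a pointwise limit, written as a lower limit to fit Fatou's lemma. *)
rewrite (eq_integral (fun w => limn_einf (u ^~ w))); last first.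
  by move=> w _; rewrite is_cvg_limn_einfE; [apply/esym/cvg_lim|apply/cvgP/ux].
apply: (le_trans (fatou _ _ _ _)) => //.
- by move=> k; exact: random_operator_norm2.
- by move=> k w _; rewrite lee_fin sqr_ge0.
rewrite -(cvg_lim _ bx) // -(is_cvg_limn_einfE (cvgP _ bx)).
rewrite !limn_einf_lim; apply: lee_lim.
- exact: is_cvg_einfs.
- exact: is_cvg_einfs.
apply: nearW => k; apply: le_ereal_inf_tmp => _ [l /= kl <-].
apply: ereal_inf_le; exists (\int[P]_w u l w)%E; first by exists l.
exact: randomized_tensor_sum.
Unshelve. all: by end_near. Qed.

End randomized.
End tensor_mean_square.

Lemma mean_square_tensor {R : realType} {d : nat} {disp : 'I_d -> measure_display}
    {Omega : forall n, measurableType (disp n)}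
    (Pn : forall n, probability (Omega n) R)
    (P : probability (product_space Omega) R)
    {F G : 'I_d -> hilbert R} (FT : hilbert_tensor F) (GT : hilbert_tensor G)
    (x : error_kind) (T : forall n, Omega n -> F n -> G n) (t : 'I_d -> R) :
  is_product_probability Pn P -> (forall n, random_operator (@T n)) ->
  (forall n, 0 <= t n) ->
  (forall n, mean_square x (Pn n) (@T n) <= (t n)%:E)%E ->
  (mean_square x P (tensor_random FT GT T) <= (\prod_n t n)%:E)%E.
Proof.
move=> prodP rT t0; case: x => Tt.
  exact: (randomized_tensor prodP FT GT rT t0 Tt).
exact: (worst_case_tensor prodP FT GT rT t0 Tt).
Qed.

(** * Multi-indices and the telescoping sum *)

Lemma sum_ord_interval (V : nmodType) L M (F : nat -> V) : (M <= L)%N ->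
  \sum_(j < L.+1 | (1 <= j <= M)%N) F j = \sum_(0 <= j < M) F j.+1.
Proof.
move=> ML; transitivity (\sum_(1 <= j < M.+1) F j); last by rewrite big_add1.
rewrite (big_nat_widen _ _ L.+1) // big_geq_mkord; apply: eq_bigl => j.
by rewrite /= ltnS andbC.
Qed.

Section multi_index.
Context {d L : nat} (L1 : (1 <= L)%N).
Implicit Type l : {ffun 'I_d -> 'I_L.+1}.

Definition admissible l := [forall n, (1 <= l n)%N] && (\sum_(n < d) l n <= L)%N.

Definition upd l (k : 'I_d) (j : 'I_L.+1) : {ffun 'I_d -> 'I_L.+1} :=
  [ffun n => if n == k then j else l n].

Definition rest (k : 'I_d) l := (\sum_(n < d | n != k) l n)%N.

(** Multi-indices with only the first [k] entries free: pinning the others to 1 keeps a single index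
    type for all partial sums of the telescope. *)
Definition ones_from (k : nat) l :=
  [forall n : 'I_d, (k <= n)%N ==> (l n == 1 :> nat)].

Lemma updE l k j n : upd l k j n = if n == k then j else l n.
Proof. by rewrite ffunE. Qed.

Lemma sum_rest k l : (\sum_(n < d) l n = l k + rest k l)%N.
Proof. by rewrite (bigD1 k). Qed.

Lemma rest_upd k l j : rest k (upd l k j) = rest k l.
Proof. by apply: eq_bigr => n /negbTE nk; rewrite updE nk. Qed.

Lemma admissible_upd k l : admissible l =
  admissible (upd l k (inord 1)) && (1 <= l k <= L - rest k l)%N.
Proof.
rewrite /admissible !(sum_rest k) rest_upd updE eqxx inordK //.
apply/idP/idP => [/andP[/forallP l1 lL]|/andP[/andP[/forallP l1 lL]] /andP[lk kL]].
  rewrite l1 andTb; apply/andP; split; last by have := l1 k; lia.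
  apply/andP; split; last by have := l1 k; lia.
  by apply/forallP => n; rewrite updE; case: eqP => // _; rewrite inordK.
apply/andP; split; last by lia.
apply/forallP => n; have := l1 n; rewrite updE.
by have [->|] := eqVneq n k.
Qed.

(** Summation along the fibres of coordinate [k]: each fibre has one representative with entry 1
    there, and the admissible entries run from 1 to what the others leave of L. *)
Lemma sum_reset (V : nmodType) (k : 'I_d) (Q : pred {ffun 'I_d -> 'I_L.+1})
    (F : {ffun 'I_d -> 'I_L.+1} -> V) :
  (forall l j, Q (upd l k j) = Q l) ->
  \sum_(l | admissible l && Q l) F l =
  \sum_(l | [&& admissible l, Q l & l k == 1 :> nat])
    \sum_(j : 'I_L.+1 | (1 <= j <= L - rest k l)%N) F (upd l k j).
Proof.
move=> Qu; rewrite pair_big_dep /=.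
rewrite (reindex_onto (fun l => (upd l k (inord 1), l k))
  (fun p => upd p.1 k p.2)) /=.
  apply: eq_big => l.
    rewrite Qu updE eqxx inordK // eqxx andbT rest_upd [in LHS](admissible_upd k).
    have -> : upd (upd l k (inord 1)) k (l k) = l.
      by apply/ffunP => n; rewrite !updE; case: eqP => [->|].
    by rewrite eqxx !andbT; case: (admissible _); case: (Q l); rewrite ?andbF ?andbT.
  move=> _; congr F; apply/ffunP => n; rewrite !updE.
  by case: eqP => [->|].
move=> [l j] /= /andP[/and3P[_ _ /eqP lk] _]; congr pair; last by rewrite updE eqxx.
apply/ffunP => n; rewrite !updE; case: eqP => // ->.
by apply/val_inj; rewrite /= inordK.
Qed.

End multi_index.

(** * Telescoping of elementary tensors *)

Section multilinear_telescope.
Context {R : realType} {d L : nat}.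
Context {G : 'I_d -> hilbert R} (GT : hilbert_tensor G).
Variables (s : forall n, G n) (u : forall n, nat -> G n).
Hypothesis u0 : forall n, u n 0%N = 0.
Hypotheses (d1 : (1 <= d)%N) (dL : (d <= L)%N).

Let delta n l := u n l - u n (l - 1)%N.

Let partial (k : nat) (l : {ffun 'I_d -> 'I_L.+1}) (n : 'I_d) : G n :=
  if (n < k)%N then delta n (l n) else s n.

Lemma tens_linear_at (k : 'I_d) (f : forall n, G n) :
  linear (fun v : G k => tens GT (dfwith f k v)).
Proof. by move=> a v w; exact: tens_linear. Qed.

Lemma sum_delta n M : (M <= L)%N ->
  \sum_(j : 'I_L.+1 | (1 <= j <= M)%N) delta n j = u n M.
Proof.
move=> ML; rewrite (sum_ord_interval (delta n)) // /delta.
under eq_bigr do rewrite subn1 /=.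
by rewrite telescope_sumr // u0 subr0.
Qed.

(** In the second sum slot k carries the sum of delta_j over 1 <= j <= L - [rest k l], which
    collapses to [u] at that level; by multilinearity the difference has s - u in slot k. *)
Lemma tens_telescope_step (k : 'I_d) :
  \sum_(l : {ffun 'I_d -> 'I_L.+1} | admissible l && ones_from k l)
     tens GT (partial k l) -
  \sum_(l : {ffun 'I_d -> 'I_L.+1} | admissible l && ones_from k.+1 l)
     tens GT (partial k.+1 l) =
  \sum_(l : {ffun 'I_d -> 'I_L.+1} | admissible l && ones_from k l)
     tens GT (dfwith (partial k l) k (s k - u k (L - rest k l)%N)).
Proof.
have L1 : (1 <= L)%N by apply: leq_trans dL.
rewrite [X in _ - X](sum_reset L1 (k := k)); last first.
  move=> l j; apply: eq_forallb => n; rewrite updE.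
  by case: (eqVneq n k) => // ->; rewrite ltnn.
have EQ (l : {ffun 'I_d -> 'I_L.+1}) :
    [&& admissible l, ones_from k.+1 l & l k == 1 :> nat] =
    admissible l && ones_from k l.
  congr (_ && _); apply/andP/forallP => [[/forallP h /eqP lk] n|h].
    apply/implyP; rewrite leq_eqVlt => /orP[/eqP/val_inj <-|]; first exact/eqP.
    exact/implyP/h.
  split; last by have /implyP := h k; apply.
  by apply/forallP => n; apply/implyP => /ltnW kn; have /implyP := h n; apply.
rewrite (eq_bigl _ _ EQ) -sumrB; apply: eq_bigr => l _.
have -> : tens GT (partial k l) = tens GT (dfwith (partial k l) k (s k)).
  congr (tens GT _); apply: functional_extensionality_dep => n.
  have [->|nk] := eqVneq n k; first by rewrite dfwithin /partial ltnn.
  by rewrite dfwithout // eq_sym.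
rewrite (linear_sub _ _ (@tens_linear_at k (partial k l))); congr (_ - _).
rewrite -(@sum_delta k) ?leq_subr //.
rewrite (big_morph _ (fun v w => linear_add v w (@tens_linear_at k (partial k l)))
  (linear_zero (@tens_linear_at k (partial k l)))).
apply: eq_bigr => j _; congr (tens GT _).
apply: functional_extensionality_dep => n.
rewrite /partial; have [->|nk] := eqVneq n k.
  by rewrite dfwithin ltnSn updE eqxx.
rewrite dfwithout 1?eq_sym // updE (negbTE nk) ltnS leq_eqVlt.
by rewrite (_ : (n == k :> nat) = false) //; apply/negbTE.
Qed.

(** Summation of the steps from k = 0, where only the index with all entries 1 occurs, to k = d,
    where no entry is pinned. *)
Lemma tens_telescope :
  tens GT s - \sum_(l : {ffun 'I_d -> 'I_L.+1} | admissible l)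
    tens GT (fun n => delta n (l n)) =
  \sum_(k < d) \sum_(l : {ffun 'I_d -> 'I_L.+1} | admissible l && ones_from k l)
     tens GT (dfwith (partial k l) k (s k - u k (L - rest k l)%N)).
Proof.
have L1 : (1 <= L)%N by apply: leq_trans dL.
under [RHS]eq_bigr do rewrite -tens_telescope_step.
pose A k := \sum_(l : {ffun 'I_d -> 'I_L.+1} | admissible l && ones_from k l)
  tens GT (partial k l).
rewrite -(big_mkord xpredT (fun k => A k - A k.+1)).
under [RHS]eq_bigr do rewrite -opprB; rewrite sumrN telescope_sumr // opprB.
congr (_ - _); last first.
  apply: eq_big => [l|l _].
    rewrite (_ : ones_from d l) ?andbT //; apply/forallP => n.
    by rewrite leqNgt ltn_ord.
  by congr (tens GT _); apply: functional_extensionality_dep => n;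
    rewrite /partial ltn_ord.
(* The index with all entries 1 is admissible because d <= L. *)
rewrite /A (big_pred1 [ffun=> inord 1]) => [|l]; first by congr (tens GT _).
apply/andP/eqP => [[_ /forallP h]|->].
  apply/ffunP => n; rewrite ffunE; apply/val_inj; rewrite /= inordK //.
  exact/eqP/(implyP (h n)).
split; last by apply/forallP => n; rewrite ffunE inordK.
apply/andP; split; first by apply/forallP => n; rewrite ffunE inordK.
under eq_bigr do rewrite ffunE inordK //.
by rewrite sum1_card card_ord.
Qed.

End multilinear_telescope.

(** * The error of the Smolyak method *)

Lemma mean_square_cst (R : realType) (disp : measure_display)
    (Omega : measurableType disp) (P : probability Omega R) x
    (F G : normedModType R) (T : F -> G) B :
  0 <= B -> (op_norm T <= B%:E)%E ->
  (mean_square x P (fun=> T) <= B%:E)%E.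
Proof.
move=> B0 /ball_sup_leP TB.
have TB2 f : `|f| <= 1 -> ((`|T f| ^+ 2)%:E <= (B ^+ 2)%:E)%E.
  by move=> /TB; rewrite !lee_fin => h; rewrite lerXn2r ?nnegrE.
have cstP c : (\int[P]_w cst c w = c)%E.
  rewrite integral_cst //; transitivity (c * 1)%E; last exact: mule1.
  by congr (_ * _)%E; exact: probability_setT.
case: x.
  by apply/mean_square_randomizedP => // f /TB2; rewrite cstP.
by apply/mean_square_worst_caseP => //; rewrite cstP; apply/ball_sup_leP.
Qed.

Lemma random_operator_sub (R : realType) (disp : measure_display)
    (Omega : measurableType disp) (F G : hilbert R) (T U : Omega -> F -> G) :
  (forall w, bounded_linear (T w)) -> (forall w, bounded_linear (U w)) ->
  (forall f, borel_measurable (fun w => T w f)) ->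
  (forall f, borel_measurable (fun w => U w f)) ->
  random_operator (fun w => T w - U w).
Proof.
move=> bT bU mT mU; split=> [w|f]; first exact: bounded_linearB.
exact: borel_measurable_norm_sub.
Qed.

Section smolyak_error.
Context {R : realType} {d : nat} (X : smolyak_setting R d) (L : nat).
Hypotheses (d1 : (1 <= d)%N) (dL : (d <= L)%N).

Lemma bounded_linear_block_op n l w : bounded_linear (block_op X n l w).
Proof.
case: l => [|l]; first exact: bounded_linear0.
exact: alg_bounded.
Qed.

Lemma bounded_linear_block_diff n l w : bounded_linear (@block_diff R d X n l w).
Proof. by apply: bounded_linearB; exact: bounded_linear_block_op. Qed.

Lemma borel_measurable_block_op n l f :
  borel_measurable (fun w => block_op X n l w f).
Proof.
case: l => [|l]; first exact: measurable_cst.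
exact: (@ralg_measurable _ _ _ _ _ _ (block X n l.+1)).
Qed.

Lemma random_operator_block_diff n l :
  random_operator (@block_diff R d X n l).
Proof.
apply: random_operator_sub => *; first [exact: bounded_linear_block_op |
  exact: borel_measurable_block_op].
Qed.

Definition factor (k : 'I_d) (l : {ffun 'I_d -> 'I_L.+1}) :
    forall n, sample X n -> source X n -> target X n :=
  dfwith (fun (n : 'I_d) w =>
    if (n < k)%N then @block_diff R d X n (l n) w else solution X n) k
    (fun w => solution X k - block_op X k (L - rest k l)%N w).

Lemma random_operator_factor k l n : random_operator (factor k l (n := n)).
Proof.
rewrite /factor; have [->|nk] := eqVneq n k.
  rewrite dfwithin; apply: random_operator_sub => *.
  - exact: solution_bounded.
  - exact: bounded_linear_block_op.
  - exact: measurable_cst.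
  - exact: borel_measurable_block_op.
rewrite dfwithout 1?eq_sym //; case: (n < k)%N.
  exact: random_operator_block_diff.
exact/random_operator_cst/solution_bounded.
Qed.

(** Both sides are bounded linear, so it is enough to compare them on elementary tensors, where
    [tens_telescope] applies. *)
Lemma smolyak_decomposition w :
  solution_d X - smolyak X L w =
  \sum_(k < d) \sum_(l : {ffun 'I_d -> 'I_L.+1} | admissible l && ones_from k l)
    tensor_random (source_d X) (target_d X) (factor k l) w.
Proof.
have bS : bounded_linear (solution_d X).
  by apply: tensor_op_bounded; exact: solution_bounded.
have bD (l : {ffun 'I_d -> 'I_L.+1}) : bounded_linear
    (tensor_op (source_d X) (target_d X) (fun n => @block_diff R d X n (l n) (w n))).
  by apply: tensor_op_bounded => n; exact: bounded_linear_block_diff.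
have bF k l n : bounded_linear (factor k l (w n)).
  by case: (random_operator_factor k l n).
have bA : bounded_linear (smolyak X L w).
  by apply: bounded_linear_sum => l _; exact: bD.
have bT k l : bounded_linear
    (tensor_random (source_d X) (target_d X) (factor k l) w).
  exact: tensor_op_bounded.
apply: tensor_op_ext.
- exact: bounded_linearB.
- by apply: bounded_linear_sum => k _; apply: bounded_linear_sum => l _.
move=> f.
have -> : (solution_d X - smolyak X L w) (tens (source_d X) f) =
    solution_d X (tens (source_d X) f) - smolyak X L w (tens (source_d X) f) by [].
rewrite /solution_d tensor_op_tens; last exact: solution_bounded.
rewrite /smolyak fct_sumE.
pose u n j := block_op X n j (w n) (f n).
have -> : \sum_(l : {ffun 'I_d -> 'I_L.+1} | admissible l) tensor_op
    (source_d X) (target_d X) (fun n => @block_diff R d X n (l n) (w n))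
      (tens (source_d X) f) =
    \sum_(l : {ffun 'I_d -> 'I_L.+1} | admissible l)
      tens (target_d X) (fun n => u n (l n) - u n (l n - 1)%N).
  apply: eq_bigr => l _; rewrite tensor_op_tens // => n.
  exact: bounded_linear_block_diff.
rewrite (@tens_telescope R d L _ (target_d X) (fun n => solution X n (f n)) u) //.
rewrite fct_sumE; apply: eq_bigr => k _.
rewrite fct_sumE; apply: eq_bigr => l _.
rewrite /tensor_random tensor_op_tens; last by move=> n; exact: bF.
congr (tens _ _); apply: functional_extensionality_dep => n; rewrite /factor.
have [->|nk] := eqVneq n k; first by rewrite !dfwithin.
by rewrite !dfwithout 1?eq_sym //; case: ifP.
Qed.

Context (x : error_kind) (H D : R).
Hypotheses (H0 : 0 < H) (D0 : 0 < D).
Hypothesis solution_le : forall n, (op_norm (solution X n) <= (H * D)%:E)%E.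
Hypothesis block_le : forall n l, (1 <= l)%N ->
  (error x (prob X n) (solution X n) (block_op X n l) <= (H * D ^+ l)%:E)%E.
Hypothesis block_diff_le : forall n l, (1 <= l)%N ->
  (mean_square x (prob X n) (@block_diff R d X n l) <= (H * D ^+ l)%:E)%E.

(** The levels of the factors add up to exactly L. The deterministic factors count as level 1, which
    is why the bound on S is written H D. *)
Lemma mean_square_factors (k : 'I_d) (l : {ffun 'I_d -> 'I_L.+1}) :
  admissible l -> ones_from k l ->
  (mean_square x (prob_d X)
     (tensor_random (source_d X) (target_d X) (factor k l)) <=
   (H ^+ d * D ^+ L)%:E)%E.
Proof.
move=> /andP[/forallP l1 lL] /forallP lk.
have restL : (rest k l < L)%N.
  by move: lL; rewrite (sum_rest k); have := l1 k; lia.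
(* The effective levels: the pinned entry 1 in slot k gives way to the level of S - U there. *)
pose e n := if n == k then (L - rest k l)%N else l n : nat.
have eL : (\sum_(n < d) e n = L)%N.
  rewrite (bigD1 k) //= {1}/e eqxx.
  have -> : (\sum_(n < d | n != k) e n = rest k l)%N.
    by apply: eq_bigr => n /negbTE nk; rewrite /e nk.
  by rewrite subnK // ltnW.
have -> : H ^+ d * D ^+ L = \prod_(n < d) (H * D ^+ e n).
  by rewrite big_split /= prodr_const card_ord -expr_sum eL.
apply: (mean_square_tensor (Pn := prob X)).
- exact: prob_d_product.
- exact: random_operator_factor.
- by move=> n; rewrite mulr_ge0 ?exprn_ge0 // ltW.
move=> n; rewrite /factor /e; have [->|nk] := eqVneq n k.
  by rewrite dfwithin; apply: block_le; rewrite subn_gt0.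
rewrite dfwithout 1?eq_sym //; case: ltnP => kn; first exact: block_diff_le.
have := lk n; rewrite kn /= => /eqP ->; rewrite expr1.
by apply: mean_square_cst; [rewrite mulr_ge0 // ltW|exact: solution_le].
Qed.

Lemma smolyak_error_le :
  (error x (prob_d X) (solution_d X) (smolyak X L) <=
   ((\sum_(k < d) #|[pred l : {ffun 'I_d -> 'I_L.+1} |
        admissible l && ones_from k l]|)%N%:R
    * (H ^+ d * D ^+ L))%:E)%E.
Proof.
pose r := [seq p : 'I_d * {ffun 'I_d -> 'I_L.+1} <- index_enum _ |
  admissible p.2 && ones_from p.1 p.2].
have HD0 : 0 < H ^+ d * D ^+ L by rewrite mulr_gt0 ?exprn_gt0.
rewrite /error.
have -> : (fun w => solution_d X - smolyak X L w) =
    fun w => \sum_(p <- r)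
      tensor_random (source_d X) (target_d X) (factor p.1 p.2) w.
  apply/funext => w; rewrite smolyak_decomposition /r big_filter.
  by rewrite pair_big_dep.
have := @mean_square_sum _ _ _ (prob_d X) x _ _ _ r (fun=> H ^+ d * D ^+ L)
  (fun p => tensor_random (source_d X) (target_d X) (factor p.1 p.2)).
move=> /(_ (fun=> HD0)) /(_ (fun p =>
  random_operator_tensor _ _ (random_operator_factor p.1 p.2))).
have rle p : p \in r -> (mean_square x (prob_d X)
     (tensor_random (source_d X) (target_d X) (factor p.1 p.2)) <=
   (H ^+ d * D ^+ L)%:E)%E.
  by rewrite mem_filter => /andP[/andP[pa po] _]; exact: mean_square_factors.
move=> /(_ rle) /le_trans; apply; rewrite lee_fin.
rewrite /r big_filter -(pair_big_dep xpredT
  (fun (k : 'I_d) (l : {ffun 'I_d -> 'I_L.+1}) => admissible l && ones_from k l)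
  (fun _ _ => H ^+ d * D ^+ L)) /=.
rewrite natr_sum mulr_suml; apply: ler_sum => k _.
by rewrite sumr_const mulr_natl.
Qed.

End smolyak_error.

(** * The cardinality of information *)

Section counting_indices.
Context {R : realType}.

Lemma geometric_le (z : R) n : 0 <= z -> z < 1 ->
  \sum_(j < n) z ^+ j <= (1 - z)^-1.
Proof.
move=> z0 z1; have z1' : 0 < 1 - z by rewrite subr_gt0.
rewrite -(@ler_pM2l _ (1 - z)) // mulfV ?gt_eqF //.
have := subrX1 z n; have : 0 <= z ^+ n by rewrite exprn_ge0.
by move=> ? ?; lra.
Qed.

Lemma geometric_sum_le (K : R) M : 1 < K ->
  \sum_(0 <= j < M) K ^+ j.+1 <= K ^+ M * (K / (K - 1)).
Proof.
move=> K1; have K10 : 0 < K - 1 by rewrite subr_gt0.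
under eq_bigr do rewrite exprSr.
rewrite -mulr_suml mulrA [leRHS]mulrAC ler_wpM2r //; first lra.
rewrite ler_pdivlMr // mulrC big_mkord -subrX1; lra.
Qed.

(* Chernoff's bound: each index counts at most z^(|l| - L), z = L / (L + m). *)
Lemma card_admissible_le m L : (1 <= m)%N -> (1 <= L)%N ->
  #|[pred l : {ffun 'I_m.+1 -> 'I_L.+1} |
      admissible l && (l ord_max == 1 :> nat)]|%:R <=
  (expR 1 * (1 + L%:R / m%:R)) ^+ m :> R.
Proof.
move=> m1 L1; have mp : 0 < m%:R :> R by rewrite ltr0n.
have Lp : 0 < L%:R :> R by rewrite ltr0n.
pose z : R := L%:R / (L%:R + m%:R).
have z0 : 0 < z by rewrite divr_gt0 // addr_gt0.
have z1 : z < 1 by rewrite ltr_pdivrMr ?addr_gt0 // mul1r ltrDl.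
have zL : z ^- L <= expR 1 ^+ m.
  have -> : z ^- L = (1 + m%:R / L%:R) ^+ L.
    by rewrite -exprVn; congr (_ ^+ _); rewrite /z; field; rewrite !gt_eqF // addr_gt0.
  apply: (@le_trans _ _ (expR (m%:R / L%:R) ^+ L)).
    by rewrite lerXn2r ?nnegrE ?expR_ge0 ?expR_ge1Dx // addr_ge0 // divr_ge0 // ltW.
  rewrite -!expRM_natl mulr1 ler_expR le_eqVlt; apply/orP; left; apply/eqP.
  by field; rewrite gt_eqF.
(* The last entry is forced to be 1. Letting the others start from 0 only enlarges the sum, and each
   becomes a geometric series with bound 1 / (1 - z) = 1 + L / m. *)
pose F (n : 'I_m.+1) (j : 'I_L.+1) : R :=
  if n == ord_max then (j == 1 :> nat)%:R else z ^+ j.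
have Fmax j : F ord_max j = (j == 1 :> nat)%:R by rewrite /F eqxx.
have F0 n j : 0 <= F n j by rewrite /F; case: ifP => // _; rewrite exprn_ge0 // ltW.
apply: (@le_trans _ _ (z ^- L *
    \sum_(l : {ffun 'I_m.+1 -> 'I_L.+1}) \prod_n F n (l n))).
  rewrite -sum1_card natr_sum mulr_sumr.
  rewrite big_mkcond /=; apply: ler_sum => l _.
  case: ifP => [/andP[/andP[_ lL] /eqP l1]|_]; last first.
    by rewrite mulr_ge0 ?invr_ge0 ?exprn_ge0 ?prodr_ge0 // ltW.
  rewrite (bigD1 ord_max) //= Fmax l1 mul1r.
  have -> : \prod_(n | n != ord_max) F n (l n) = z ^+ rest ord_max l.
    by rewrite expr_sum; apply: eq_bigr => n /negbTE nm; rewrite /F nm.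
  rewrite mulrC ler_pdivlMr ?exprn_gt0 // mul1r.
  apply: ler_wiXn2l; [exact: ltW|exact: ltW|].
  by move: lL; rewrite (sum_rest ord_max) l1; lia.
rewrite -bigA_distr_bigA (bigD1 ord_max) //=.
have -> : \sum_j F ord_max j = 1.
  rewrite (bigD1 (inord 1)) //= Fmax inordK // big1 ?addr0 // => j j1.
  rewrite Fmax (_ : (j == 1 :> nat) = false) //; apply/negbTE.
  by apply: contra j1 => /eqP j1; apply/eqP/val_inj; rewrite /= inordK.
rewrite mul1r [leRHS]exprMn; apply: ler_pM => //.
- by rewrite invr_ge0 exprn_ge0 // ltW.
- by apply: prodr_ge0 => n _; apply: sumr_ge0.
apply: (@le_trans _ _ (\prod_(n < m.+1 | n != ord_max) (1 + L%:R / m%:R))).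
  apply: ler_prod => n /negbTE nm; rewrite sumr_ge0 //= /F nm.
  apply: (le_trans (geometric_le _ (ltW z0) z1)).
  rewrite le_eqVlt; apply/orP; left; apply/eqP; rewrite /z; field.
  by rewrite !gt_eqF // ?addr_gt0 // addrC addrK.
by rewrite prodr_const cardC1 card_ord.
Qed.

Lemma card_admissible1 L : (#|[pred l : {ffun 'I_1 -> 'I_L.+1} |
  admissible l && (l ord_max == 1 :> nat)]| <= 1)%N.
Proof.
apply/card_le1_eqP => l l' /andP[_ /eqP l1] /andP[_ /eqP l'1].
apply/ffunP => n; rewrite (_ : n = ord_max); last by rewrite !ord1.
by apply/val_inj; rewrite /= l1 l'1.
Qed.

Lemma card_ones_from_le m L (k : 'I_m.+1) :
  (#|[pred l : {ffun 'I_m.+1 -> 'I_L.+1} | admissible l && ones_from k l]| <=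
   #|[pred l : {ffun 'I_m.+1 -> 'I_L.+1} |
      admissible l && (l ord_max == 1 :> nat)]|)%N.
Proof.
apply: subset_leq_card; apply/fintype.subsetP => l.
rewrite !inE => /andP[al /forallP h]; apply/andP; split=> //.
by have /implyP := h ord_max; apply; rewrite /= -ltnS.
Qed.

(** For fixed other entries, the geometric sum in the last one is at most K / (K - 1) times the top
    power, and that power completes K^|l| to K^L. *)
Lemma sum_admissible_exp m L (K : R) : 1 < K -> (1 <= L)%N ->
  \sum_(l : {ffun 'I_m.+1 -> 'I_L.+1} | admissible l) K ^+ (\sum_(n < m.+1) l n)%N <=
  #|[pred l : {ffun 'I_m.+1 -> 'I_L.+1} |
      admissible l && (l ord_max == 1 :> nat)]|%:R * (K ^+ L * (K / (K - 1))).
Proof.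
move=> K1 L1; have K0 : 0 < K by exact: lt_trans K1.
rewrite (eq_bigl (fun l => admissible l && true)) => [|l]; last by rewrite andbT.
rewrite (sum_reset L1 (k := ord_max) (Q := xpredT)) //=.
rewrite mulr_natl -sumr_const; apply: ler_sum => l /andP[/andP[_ lL] /eqP l1].
have rL : (rest ord_max l <= L)%N by move: lL; rewrite (sum_rest ord_max) l1; lia.
under eq_bigr do rewrite (sum_rest ord_max) updE eqxx rest_upd exprD.
rewrite -mulr_suml (sum_ord_interval (fun j => K ^+ j)) ?leq_subr //.
apply: (@le_trans _ _ (K ^+ (L - rest ord_max l) * (K / (K - 1)) *
    K ^+ rest ord_max l)).
  by rewrite ler_wpM2r ?exprn_ge0 ?geometric_sum_le // ltW.
by rewrite mulrAC -exprD subnK.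
Qed.

Lemma counting_le (T : choiceType) (I : finType) (Q : pred I) (f : I -> T)
    (A : set T) : (forall a, A a -> exists2 i, Q i & a = f i) ->
  (counting A <= #|Q|%:R%:E :> \bar R)%E.
Proof.
move=> Af; pose s := [seq f i | i <- enum Q].
have As : A `<=` [set` [fset x in s]%fset].
  by move=> a /Af[i Qi ->] /=; rewrite inE; apply/mapP; exists i; rewrite ?mem_enum.
have finA : finite_set A by apply: sub_finite_set As _; exact: finite_fset.
rewrite /counting asboolT // lee_fin ler_nat.
apply: (@leq_trans #|` [fset x in s]%fset|); last first.
  by rewrite card_fseq (leq_trans (size_undup _)) // size_map cardE.
apply: fsubset_leq_card; rewrite -[X in (_ `<=` X)%fset]set_fsetK.
by rewrite -fset_set_sub //; exact: finite_fset.
Qed.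

Lemma counting_ge1 (T : choiceType) (A : set T) a : A a ->
  (1 <= counting A :> \bar R)%E.
Proof.
move=> Aa; rewrite /counting; case: asboolP => [finA|_]; last exact: leey.
rewrite lee_fin ler1n cardfs_gt0; apply/fset0Pn; exists a.
by rewrite in_fset_set //; exact: mem_set.
Qed.

End counting_indices.

(** * Expected number of functionals *)

Section smolyak_cardinality.
Context {R : realType} {d : nat} (X : smolyak_setting R d).

Lemma block_card_ge0 l n : (0 <= block_card X l n)%E.
Proof.
by case: l => // l; apply: integral_ge0 => w _; rewrite lee_fin.
Qed.

Lemma block_card_le (Kup K : R) n :
  (forall l, (1 <= l)%N -> (block_card X l n - block_card X (l - 1) n <=
    (Kup * K ^+ (l - 1) * (K - 1))%:E)%E) ->
  forall l, (block_card X l n <= (Kup * (K ^+ l - 1))%:E)%E.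
Proof.
move=> h; elim=> [|l IH]; first by rewrite expr0 subrr mulr0.
have fin : block_card X l n \is a fin_num.
  by rewrite ge0_fin_numE ?block_card_ge0 // (le_lt_trans IH) // ltry.
have := h l.+1 isT; rewrite subn1 /= leeBlDr // => /le_trans; apply.
apply: (le_trans (leeD2l _ IH)).
by rewrite -EFinD lee_fin exprS le_eqVlt; apply/orP; left; apply/eqP; ring.
Qed.

Lemma measurable_alg_card n l :
  measurable_fun setT (fun w => (alg_card (block X n l w))%:R : R).
Proof.
have := @ralg_card_measurable _ _ _ _ _ _ (block X n l).
by apply: (measurableT_comp (f := fun k : nat => k%:R : R)).
Qed.

(** A functional is determined by an index and one functional per coordinate, so it is enough to
    count these choices. Different choices may give the same functional, hence an inequality. *)
Lemma counting_smolyak_info L w : (counting (@smolyak_info R d X L w) <=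
  (\sum_(l : {ffun 'I_d -> 'I_L.+1} | admissible l)
     \prod_n (alg_card (block X n (l n) (w n)))%:R)%:E :> \bar R)%E.
Proof.
(* The choices of one functional per coordinate, a finite type depending on l. *)
pose J (l : {ffun 'I_d -> 'I_L.+1}) : finType :=
  {dffun forall n, 'I_(alg_card (block X n (l n) (w n)))}.
pose f (p : {l : {ffun 'I_d -> 'I_L.+1} & J l}) :=
  tensor_functional (source_d X) (fun n => alg_info (tagged p n)).
have := @counting_le R _ _ (fun p => admissible (tag p)) f (@smolyak_info R d X L w).
have -> : #|(fun p : {l : {ffun 'I_d -> 'I_L.+1} & J l} => admissible (tag p))|%:R =
    \sum_(l : {ffun 'I_d -> 'I_L.+1} | admissible l)
      \prod_n (alg_card (block X n (l n) (w n)))%:R :> R.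
  rewrite -sum1_card natr_sum.
  transitivity (\sum_(p : {l : {ffun 'I_d -> 'I_L.+1} & J l} |
      admissible (tag p) && true) (1 : R)).
    by apply: eq_bigl => p; rewrite andbT.
  rewrite -(@sig_big_dep _ _ _ _ J (fun l => admissible l) (fun _ _ => true)
    (fun _ _ => 1)).
  apply: eq_bigr => l _; rewrite sumr_const card_dep_ffun foldrE big_map big_enum.
  by rewrite natr_prod; apply: eq_bigr => n _; rewrite card_ord.
apply=> lam [l [l1 lL [i ->]]].
have [l' El] : exists l' : {ffun 'I_d -> 'I_L.+1}, l = fun n => l' n : nat.
  exists [ffun n => inord (l n)]; apply/funext => n; rewrite ffunE inordK // ltnS.
  case/andP: lL => _; apply: leq_trans.
  by rewrite (bigD1 n) //= leq_addr.
subst l; exists (Tagged J [ffun n => i n]).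
  by apply/andP; split; [apply/forallP|case/andP: lL].
congr (tensor_functional _ _); apply: functional_extensionality_dep => n.
by rewrite /= ffunE.
Qed.

Lemma integral_alg_card (l : 'I_d -> nat) : (forall n, 1 <= l n)%N ->
  (forall n, block_card X (l n) n < +oo)%E ->
  (\int[prob_d X]_w (\prod_n (alg_card (block X n (l n) (w n)))%:R)%:E =
   \prod_n block_card X (l n) n)%E.
Proof.
move=> l1 loo.
have E n : block_card X (l n) n =
    (\int[prob X n]_w (alg_card (block X n (l n) w))%:R%:E)%E.
  by have := l1 n; case: (l n).
rewrite (integral_product (@prob_d_product _ _ X)
  (f := fun n w => (alg_card (block X n (l n) w))%:R)) //.
- by apply: eq_bigr => n _; rewrite E.
- by move=> n; exact: measurable_alg_card.
- by move=> n; rewrite -E.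
Qed.

(** Independence gives the expected number of choices for l as the product of the m_{l_n,n}, each at
    most Kup K^{l_n}. *)
Lemma smolyak_card_le (Kup K : R) L : 0 <= Kup -> 1 < K ->
  (forall n l, (1 <= l)%N -> (block_card X l n - block_card X (l - 1) n <=
    (Kup * K ^+ (l - 1) * (K - 1))%:E)%E) ->
  (smolyak_card X L <= (Kup ^+ d *
    \sum_(l : {ffun 'I_d -> 'I_L.+1} | admissible l) K ^+ (\sum_(n < d) l n)%N)%:E)%E.
Proof.
move=> Kup0 K1 h.
have cardK n l : (block_card X l n <= (Kup * K ^+ l)%:E)%E.
  apply: (le_trans (block_card_le (h n) l)); rewrite lee_fin ler_wpM2l //.
  by rewrite gerBl.
have K0 : 0 < K by exact: lt_trans K1.
apply: (@le_trans _ _ (\int[prob_d X]_w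
  (\sum_(l : {ffun 'I_d -> 'I_L.+1} | admissible l)
     \prod_n (alg_card (block X n (l n) (w n)))%:R)%:E)%E).
  apply: le_integral_nonneg => w; last exact: counting_smolyak_info.
  by rewrite /counting; case: asboolP => // _; rewrite lee_fin.
under eq_integral do rewrite -sumEFin -big_filter.
rewrite ge0_integral_sum //; last 2 first.
- move=> l; apply/measurable_EFinP; apply: measurable_prod => n _.
  apply: (@measurable_coordinate_comp R d _ (sample X) n
    (fun w => (alg_card (block X n (l n) w))%:R)).
  exact: measurable_alg_card.
- by move=> l w _; rewrite lee_fin prodr_ge0.
rewrite big_filter mulr_sumr -sumEFin; apply: lee_sum => l /andP[/forallP l1 _].
rewrite (integral_alg_card l1); last first.
  by move=> n; exact: le_lt_trans (cardK _ _) (ltry _).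
have fin n : block_card X (l n) n = (fine (block_card X (l n) n))%:E.
  by rewrite fineK // ge0_fin_numE ?block_card_ge0 // (le_lt_trans (cardK _ _)) ?ltry.
rewrite (eq_bigr _ (fun n _ => fin n)) prodEFin lee_fin.
have -> : Kup ^+ d * K ^+ (\sum_(n < d) l n) = \prod_(n < d) (Kup * K ^+ l n).
  by rewrite big_split /= prodr_const card_ord -expr_sum.
apply: ler_prod => n _; rewrite -!lee_fin -fin block_card_ge0.
exact: cardK.
Qed.

End smolyak_cardinality.

(** A positive mean cardinality of U_L makes the event that U_L uses some functional have positive
    probability, and on this event the set of functionals is nonempty. *)
Lemma smolyak_card_gt0 (R : realType) (X : smolyak_setting R 1) L :
  (1 <= L)%N -> (0 < block_card X L ord0)%E -> (0 < smolyak_card X L)%E.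
Proof.
move=> L1 card0.
pose f (n : 'I_1) w : R := (0 < alg_card (block X n L w))%N%:R.
have f0 n w : 0 <= f n w by rewrite /f.
have mf n : measurable_fun setT (f n).
  have := @ralg_card_measurable _ _ _ _ _ _ (block X n L).
  by apply: (measurableT_comp (f := fun k : nat => (0 < k)%N%:R : R)).
have fle n w : f n w <= 1 by rewrite /f lern1 leq_b1.
have fint : (\int[prob_d X]_w (\prod_n f n (w n))%:E =
    \int[prob X ord0]_w (f ord0 w)%:E)%E.
  rewrite (integral_product (@prob_d_product _ _ X)) // ?big_ord1 // => n.
  apply: (@le_lt_trans _ _ (\int[prob X n]_w cst 1 w)%E); last first.
    rewrite integral_cst // mul1e; apply: le_lt_trans (probability_le1 _ _) _ => //.
    exact: ltry.
  by apply: le_integral_nonneg => w /=; rewrite lee_fin.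
apply: (@lt_le_trans _ _ (\int[prob X ord0]_w (f ord0 w)%:E)%E).
  rewrite lt_def integral_ge0 ?andbT => [|w _]; last by rewrite lee_fin.
  apply: contraTN card0 => /eqP int0; rewrite -leNgt.
  have mF : measurable_fun setT (EFin \o f ord0) by exact/measurable_EFinP.
  have /(ae_eq_integral_abs _ measurableT mF) ae0 :
      (\int[prob X ord0]_w `|(EFin \o f ord0) w| = 0)%E.
    by rewrite -[RHS]int0; apply: eq_integral => w _ /=; rewrite ger0_norm.
  pose c w : \bar R := (alg_card (block X ord0 L w))%:R%:E.
  have mc : measurable_fun setT c.
    by apply/measurable_EFinP; exact: measurable_alg_card.
  have : (\int[prob X ord0]_w `|c w| = 0)%E.
    apply/(ae_eq_integral_abs _ measurableT mc); apply: filterS ae0 => w /= h Tw.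
    have := h Tw; rewrite /f /c => -[/eqP]; rewrite pnatr_eq0 eqb0 -eqn0Ngt.
    by move=> /eqP ->.
  move=> c0; rewrite (_ : block_card X L ord0 = 0%E) //.
  have -> : block_card X L ord0 = (\int[prob X ord0]_w c w)%E.
    by case: L L1 @c {mc c0 f f0 mf fle fint int0 mF ae0}.
  by rewrite -[RHS]c0; apply: eq_integral => w _; rewrite gee0_abs // lee_fin.
rewrite -fint; apply: le_integral_nonneg => w; first by rewrite lee_fin prodr_ge0.
rewrite big_ord1 /f; case: posnP => [_|w0].
  by rewrite /counting; case: asboolP => _; rewrite ?lee_fin ?leey ?ler0n.
have i (n : 'I_1) : 'I_(alg_card (block X n L (w n))).
  by rewrite (_ : n = ord0) ?ord1 //; exact: Ordinal w0.
apply: (@counting_ge1 _ _ _ (tensor_functional (source_d X) (fun n => alg_info (i n)))).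
(* In dimension one the window L - d + 1 <= |l| <= L is the single level L. *)
exists (fun=> L); split=> //; last by exists i.
by rewrite big_ord1; lia.
Qed.

(** * Error versus cost *)

Section cost_error_tradeoff.
Context {R : realType}.
Implicit Types (a c q s : R).

(* [(1 + s)^(a + 1) e^(- a s)] first increases and then decreases in s, so    *)
(* that only an upper bound on s is needed.                                   *)
Lemma tradeoff a c q s : 0 < a -> 1 <= c -> 0 <= q -> 0 <= s ->
  expR s <= c * (1 + q) * expR q ->
  (1 + q) * expR (- (a * q)) <=
  (1 + a^-1) * c `^ a * ((1 + s) `^ (a + 1) * expR (- (a * s))).
Proof.
move=> a0 c1 q0 s0 sq.
have c0 : 0 < c by apply: lt_le_trans c1.
have ia : 0 < a^-1 by rewrite invr_gt0.
have ca : 1 <= c `^ a.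
  apply: (@le_trans _ _ (1 `^ a)); first by rewrite powR1.
  by apply: ge0_ler_powR; rewrite ?nnegrE // ltW.
(* If s <= q, the factor exp(-a(q - s)) absorbs 1 + (q - s). If q <= s, the a-th power of the
   hypothesis bounds exp(-a q), and 1 + q <= 1 + s. *)
have [sleq|/ltW qles] := leP s q.
  have h1 : 1 + q <= (1 + s) * (1 + (q - s)) by nra.
  have h2 : 1 + (q - s) <= (1 + a^-1) * expR (a * (q - s)).
    apply: (@le_trans _ _ ((1 + a^-1) * (1 + a * (q - s)))); last first.
      by rewrite ler_wpM2l ?expR_ge1Dx //; lra.
    have -> : (1 + a^-1) * (1 + a * (q - s)) = 1 + a * (q - s) + a^-1 + (q - s).
      by field; rewrite gt_eqF.
    have : 0 <= a * (q - s) by rewrite mulr_ge0 ?subr_ge0 // ltW.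
    by lra.
  have h3 : 1 + s <= (1 + s) `^ (a + 1).
    by rewrite -{1}[1 + s]powRr1 ?addr_ge0 // ler_powR; lra.
  have -> : expR (- (a * q)) = (expR (a * (q - s)))^-1 * expR (- (a * s)).
    by rewrite -expRN -expRD; congr expR; ring.
  rewrite mulrA [leRHS]mulrA ler_pM2r ?expR_gt0 // ler_pdivrMr ?expR_gt0 //.
  apply: (le_trans h1).
  apply: (@le_trans _ _ ((1 + s) * ((1 + a^-1) * expR (a * (q - s))))).
    by rewrite ler_wpM2l // addr_ge0.
  rewrite mulrA ler_pM2r ?expR_gt0 // [leLHS]mulrC -mulrA ler_pM2l; last lra.
  by apply: (le_trans h3); rewrite ler_peMl // powR_ge0.
have h1 : expR (- (a * q)) <= c `^ a * (1 + q) `^ a * expR (- (a * s)).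
  have : expR s `^ a <= (c * (1 + q) * expR q) `^ a.
    apply: ge0_ler_powR;
      by rewrite ?nnegrE ?expR_ge0 ?mulr_ge0 ?expR_ge0 ?addr_ge0 // ltW.
  have q1 : 0 <= 1 + q by rewrite addr_ge0.
  rewrite !powRM ?expR_ge0 // ?(mulr_ge0 (ltW c0)) ?(ltW c0) // -!expRM.
  rewrite !expRN [s * a]mulrC [q * a]mulrC => h.
  by rewrite -ler_pdivrMr ?invr_gt0 ?expR_gt0 // invrK mulrC ler_pdivrMr ?expR_gt0.
apply: (le_trans (ler_wpM2l (addr_ge0 ler01 q0) h1)).
rewrite !mulrA ler_pM2r ?expR_gt0 //.
have -> : (1 + q) * c `^ a * (1 + q) `^ a = c `^ a * (1 + q) `^ (a + 1).
  rewrite powRD ?powRr1 ?addr_ge0 //; first ring.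
  by apply/implyP => _; rewrite gt_eqF //; lra.
have h2 : (1 + q) `^ (a + 1) <= (1 + s) `^ (a + 1).
  by apply: ge0_ler_powR; rewrite ?nnegrE ?addr_ge0 ?lerD2l // ltW.
rewrite -mulrA; apply: (@le_trans _ _ (c `^ a * (1 + s) `^ (a + 1))).
  by rewrite ler_wpM2l // powR_ge0.
by rewrite ler_peMl ?lerDl ?mulr_ge0 ?powR_ge0 // ltW.
Qed.

Lemma expR1_ge1 : 1 <= expR 1 :> R.
Proof. by rewrite -[leLHS]expR0 ler_expR. Qed.

End cost_error_tradeoff.

(** * Elimination of the level *)

Section final_estimate.
Context {R : realType} (K D M H : R).
Hypotheses (K1 : 1 < K) (D0 : 0 < D) (D1 : D < 1) (M1 : 1 <= M) (H1 : 1 <= H).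
Local Definition alpha := ln (1 / D) / ln K.
Let lK : 0 < ln K. Proof. by rewrite ln_gt0. Qed.

(** Chosen so that 1 + L/m <= C_log (1 + q) with q = L ln K / m. *)
Local Definition C_log := 1 + (ln K)^-1.
(** The constant c in [tradeoff]; the square comes from m + 1 <= 2 m, to bound an (m+1)-st power by
    an m-th one. *)
Local Definition C_cost := (M * expR 1) ^+ 2 * C_log.
(** The constant that [tradeoff] yields for c = [C_cost]. *)
Local Definition C_rate := (1 + alpha^-1) * C_cost `^ alpha.

Definition rate_const := 2 * H * expR 1 * C_log * C_rate.

Lemma alpha_gt0 : 0 < alpha.
Proof. by rewrite divr_gt0 // ln_gt0 // div1r invf_gt1. Qed.

Lemma expr_K L : K ^+ L = expR (L%:R * ln K).
Proof. by rewrite expRM_natl lnK // posrE (lt_trans ltr01). Qed.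

Lemma expr_D L : D ^+ L = expR (- (alpha * (L%:R * ln K))).
Proof.
rewrite (_ : - _ = L%:R * ln D) ?expRM_natl ?lnK ?posrE //.
by rewrite /alpha div1r lnV ?posrE //; field; rewrite gt_eqF.
Qed.

Let C_log_ge1 : 1 <= C_log. Proof. by rewrite lerDl invr_ge0 ltW. Qed.

Let Me_ge1 : 1 <= M * expR 1.
Proof. by rewrite -[leLHS]mulr1 ler_pM // expR1_ge1. Qed.

Let C_cost_geM : M <= C_cost.
Proof.
have e1 := @expR1_ge1 R; have M0 : 0 <= M := le_trans ler01 M1.
have h : M <= M * expR 1 by rewrite ler_peMr.
apply: (le_trans h); rewrite /C_cost -[leLHS]mulr1 ler_pM //; first lra.
by rewrite expr2 ler_peMr //; lra.
Qed.

Let C_cost_ge1 : 1 <= C_cost. Proof. exact: le_trans C_cost_geM. Qed.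

Let C_cost_alpha_ge1 : 1 <= C_cost `^ alpha.
Proof.
apply: (@le_trans _ _ (1 `^ alpha)); first by rewrite powR1.
apply: ge0_ler_powR; rewrite ?nnegrE //.
- exact/ltW/alpha_gt0.
- exact: le_trans C_cost_ge1.
Qed.

Let C_rate_ge : C_cost `^ alpha <= C_rate.
Proof.
by rewrite /C_rate ler_peMl ?powR_ge0 // lerDl invr_ge0 ltW // alpha_gt0.
Qed.

Let C_rate_ge1 : 1 <= C_rate. Proof. exact: le_trans C_cost_alpha_ge1 C_rate_ge. Qed.

(** Since D^L = (K^L)^(-alpha), the cost bound K^L >= N / M gives D^L <= M^alpha N^(-alpha). *)
Lemma rate_one L (N : R) : 0 < N -> N <= M * K ^+ L ->
  2 * H * D ^+ L <= rate_const * N `^ (- alpha).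
Proof.
move=> N0 NM; have e1 := @expR1_ge1 R; have a0 := alpha_gt0.
have M0 : 0 < M := lt_le_trans ltr01 M1.
have H0 : 0 < H := lt_le_trans ltr01 H1.
have [Clog1 Crate1] := (C_log_ge1, C_rate_ge1).
have h : D ^+ L <= M `^ alpha * N `^ (- alpha).
  rewrite powRN ler_pdivlMr ?powR_gt0 //.
  apply: (@le_trans _ _ (D ^+ L * (M * K ^+ L) `^ alpha)).
    rewrite ler_wpM2l ?exprn_ge0 ?(ltW D0) //; apply: ge0_ler_powR => //.
    - exact: ltW.
    - by rewrite nnegrE ltW.
    - by rewrite nnegrE (le_trans _ NM) // ltW.
  have K0 : 0 <= K by rewrite ltW // (lt_trans ltr01).
  rewrite powRM ?exprn_ge0 // ?(ltW M0) //.
  rewrite expr_D expr_K -expRM mulrCA -expRD.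
  by rewrite [alpha * _]mulrC addNr expR0 mulr1.
apply: (@le_trans _ _ (2 * H * (M `^ alpha * N `^ (- alpha)))).
  by rewrite ler_wpM2l //; lra.
rewrite mulrA ler_wpM2r ?powR_ge0 //.
have hM : M `^ alpha <= C_rate.
  have cM := C_cost_geM; apply: le_trans C_rate_ge.
  by apply: ge0_ler_powR; rewrite ?nnegrE //; lra.
rewrite /rate_const; apply: ler_pM => //; [lra|exact: powR_ge0|].
have ec : 1 <= expR 1 * C_log by rewrite -[leLHS]mulr1 ler_pM.
have -> : 2 * H * expR 1 * C_log = 2 * H * (expR 1 * C_log) by rewrite -[LHS]mulrA.
by rewrite ler_peMr //; lra.
Qed.

(** Taking m-th roots in terms of q = L ln K / m and s = ln N / m leaves the hypothesis and
    conclusion of [tradeoff]; N >= 1 gives s >= 0. *)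
Lemma rate_many m L (N : R) : (1 <= m)%N -> 1 <= N ->
  N <= (M * expR 1) ^+ m.+1 * (1 + L%:R / m%:R) ^+ m * K ^+ L ->
  (2 * H * expR 1) ^+ m.+1 * (1 + L%:R / m%:R) ^+ m * D ^+ L <=
  rate_const ^+ m.+1 *
    (1 + ln N / m%:R) `^ (m%:R * (alpha + 1)) * N `^ (- alpha).
Proof.
move=> m1 N1 NM; have e1 := @expR1_ge1 R; have a0 := alpha_gt0.
have H0 : 0 < H := lt_le_trans ltr01 H1.
have [Clog1 Crate1] := (C_log_ge1, C_rate_ge1).
have m0 : 0 < m%:R :> R by rewrite ltr0n.
have N0 : 0 < N by lra.
pose s := ln N / m%:R; pose q := L%:R * ln K / m%:R.
have s0 : 0 <= s by rewrite divr_ge0 ?ln_ge0 // ltW.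
have q0 : 0 <= q by rewrite divr_ge0 ?mulr_ge0 ?(ltW lK) // ltW.
have Ns : N = expR s ^+ m by rewrite -expRM_natl /s mulrC divfK ?gt_eqF // lnK.
have Kq : K ^+ L = expR q ^+ m.
  by rewrite -expRM_natl /q mulrC divfK ?gt_eqF // expr_K.
have Dq : D ^+ L = expR (- (alpha * q)) ^+ m.
  by rewrite -expRM_natl expr_D /q; congr expR; field; rewrite gt_eqF.
have Q0 : 0 <= 1 + L%:R / m%:R :> R by rewrite addr_ge0 // divr_ge0.
have Qq : 1 + L%:R / m%:R <= C_log * (1 + q).
  rewrite (_ : C_log * (1 + q) = 1 + (ln K)^-1 + q + L%:R / m%:R).
    by have : 0 < (ln K)^-1; [rewrite invr_gt0|lra].
  by rewrite /C_log /q; field; rewrite !gt_eqF.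
have sq : expR s <= C_cost * (1 + q) * expR q.
  have rhs0 : 0 <= C_cost * (1 + q) * expR q.
    rewrite mulr_ge0 ?expR_ge0 // mulr_ge0 ?addr_ge0 //.
    exact: le_trans ler01 C_cost_ge1.
  rewrite -(@ler_pXn2r _ m) ?nnegrE ?expR_ge0 // -Ns; apply: (le_trans NM).
  have c10 : 0 <= C_log * (1 + q) := le_trans Q0 Qq.
  rewrite [leRHS]exprMn -Kq ler_pM2r ?exprn_gt0 ?(lt_trans ltr01) //.
  rewrite /C_cost -mulrA [leRHS]exprMn -exprM; apply: ler_pM.
  - by rewrite exprn_ge0 // (le_trans ler01).
  - exact: exprn_ge0.
  - apply: ler_weXn2l; first exact: Me_ge1.
    by rewrite mul2n -addnn -addn1 leq_add2l.
  - by rewrite lerXn2r ?nnegrE // (le_trans Q0).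
have key := tradeoff a0 C_cost_ge1 q0 s0 sq; rewrite -/C_rate in key.
set phi := _ * expR (- (alpha * s)) in key.
have phi0 : 0 <= phi by rewrite mulr_ge0 ?powR_ge0 ?expR_ge0.
have phiE : (1 + ln N / m%:R) `^ (m%:R * (alpha + 1)) * N `^ (- alpha) = phi ^+ m.
  rewrite -/s /phi [RHS]exprMn [m%:R * _]mulrC powRrM powR_mulrn ?powR_ge0 //.
  congr (_ * _); rewrite Ns -expRM_natl -expRM -expRM_natl; congr expR; ring.
rewrite -mulrA -[leRHS]mulrA phiE.
have G0 : 0 <= 2 * H * expR 1 by rewrite !mulr_ge0 //; lra.
have c13 : 1 <= C_log * C_rate by rewrite -[leLHS]mulr1 ler_pM.
have -> : rate_const ^+ m.+1 = (2 * H * expR 1) ^+ m.+1 * (C_log * C_rate) ^+ m.+1.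
  by rewrite -exprMn /rate_const; congr (_ ^+ _); ring.
rewrite -[leRHS]mulrA ler_wpM2l ?exprn_ge0 //.
apply: (@le_trans _ _ ((C_log * C_rate) ^+ m * phi ^+ m)); last first.
  by rewrite ler_wpM2r ?exprn_ge0 // ler_weXn2l.
have c130 : 0 <= C_log * C_rate * phi by rewrite mulr_ge0 // (le_trans ler01 c13).
have lhs0 : 0 <= (1 + L%:R / m%:R) * expR (- (alpha * q)).
  by rewrite mulr_ge0 ?expR_ge0.
rewrite Dq -!exprMn lerXn2r ?nnegrE //.
apply: (@le_trans _ _ (C_log * (1 + q) * expR (- (alpha * q)))).
  by rewrite ler_wpM2r ?expR_ge0.
have -> : C_log * (1 + q) * expR (- (alpha * q)) =
  C_log * ((1 + q) * expR (- (alpha * q))) by rewrite -[LHS]mulrA.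
have -> : C_log * C_rate * phi = C_log * (C_rate * phi) by rewrite -[LHS]mulrA.
by apply: ler_wpM2l key; exact: le_trans ler01 C_log_ge1.
Qed.

End final_estimate.

(** * Assembly of the error and cost bounds *)

Unset Implicit Arguments.
Set Strict Implicit.
Set Printing Implicit Defensive.

(** [H] dominates B/D, C and E, so a single constant serves all kinds of factors. The power of 2
    absorbs the m + 1 positions of S - U, and [M] the factor K/(K - 1) of the geometric series. *)
Lemma smolyak_setting_bounds (R : realType) (x : error_kind) (B C E D Kup K : R)
    (m : nat) (X : smolyak_setting R m.+1) :
  0 < B -> 0 < C -> 0 < E -> 0 < D -> 1 <= Kup -> 1 < K ->
  (forall n, op_norm (solution X n) <= B%:E)%E ->
  (forall n l, (1 <= l)%N ->
     error x (prob X n) (solution X n) (block_op X n l) <= (C * D ^+ l)%:E)%E ->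
  (forall n l, (1 <= l)%N ->
     mean_square x (prob X n) (@block_diff R m.+1 X n l) <= (E * D ^+ l)%:E)%E ->
  (forall n l, (1 <= l)%N -> block_card X l n - block_card X (l - 1) n <=
     (Kup * K ^+ (l - 1) * (K - 1))%:E)%E ->
  let H := 1 + B / D + C + E in
  let M := Kup * (K / (K - 1)) in
  forall L, (m < L)%N ->
  let c := #|[pred l : {ffun 'I_m.+1 -> 'I_L.+1} |
      admissible l && (l ord_max == 1 :> nat)]|%:R : R in
  (error x (prob_d X) (solution_d X) (smolyak X L) <=
     ((2 * H) ^+ m.+1 * c * D ^+ L)%:E)%E /\
  (smolyak_card X L <= (M ^+ m.+1 * c * K ^+ L)%:E)%E.
Proof.
move=> B0 C0 E0 D0 Kup1 K1 hS hU hD hK H M L mL c.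
have BD0 : 0 < B / D by rewrite divr_gt0.
have H0 : 0 < H by rewrite /H; lra.
have L1 : (1 <= L)%N by apply: leq_ltn_trans mL.
have weaken (u v : R) l : u <= v -> ((u * D ^+ l)%:E <= (v * D ^+ l)%:E)%E.
  by move=> uv; rewrite lee_fin ler_wpM2r // exprn_ge0 // ltW.
split.
  apply: (le_trans (@smolyak_error_le R m.+1 X L isT mL x H D H0 D0 _ _ _)).
  - move=> n; apply: (le_trans (hS n)); rewrite lee_fin -ler_pdivrMr //.
    by rewrite /H; lra.
  - move=> n l l1; apply: (le_trans (hU n l l1)); apply: weaken.
    by rewrite /H; lra.
  - move=> n l l1; apply: (le_trans (hD n l l1)); apply: weaken.
    by rewrite /H; lra.
  rewrite lee_fin !mulrA ler_wpM2r ?exprn_ge0 ?(ltW D0) //.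
  rewrite exprMn mulrAC ler_wpM2r ?exprn_ge0 ?(ltW H0) //.
  apply: (@le_trans _ _ ((m.+1)%:R * c)).
    rewrite natr_sum -[m.+1 in leRHS]card_ord -sum1_card natr_sum mulr_suml.
    by apply: ler_sum => k _; rewrite mul1r ler_nat card_ones_from_le.
  by rewrite ler_wpM2r // -natrX ler_nat ltnW // ltn_expl.
have Kup0 : 0 <= Kup by exact: le_trans Kup1.
apply: (le_trans (smolyak_card_le L Kup0 K1 hK)); rewrite lee_fin.
apply: (@le_trans _ _ (Kup ^+ m.+1 * (c * (K ^+ L * (K / (K - 1)))))).
  by rewrite ler_wpM2l ?exprn_ge0 // sum_admissible_exp.
have K10 : 0 < K - 1 by rewrite subr_gt0.
have r1 : 1 <= K / (K - 1) by rewrite ler_pdivlMr // mul1r gerBl.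
rewrite /M exprMn -!mulrA ler_wpM2l ?exprn_ge0 //.
rewrite [leRHS]mulrC -!mulrA ler_wpM2l // ler_wpM2l ?exprn_ge0 //; first lra.
by rewrite exprS ler_peMr ?exprn_ege1 //; lra.
Qed.

Theorem theorem7 (R : realType) (x : error_kind) (B C E D Klow Kup K : R)
    (B_gt0 : 0 < B) (C_gt0 : 0 < C) (E_gt0 : 0 < E)
    (D_gt0 : 0 < D) (D_lt1 : D < 1)
    (Klow_ge1 : 1 <= Klow) (Klow_le_Kup : Klow <= Kup) (K_gt1 : 1 < K)
    (X : forall d, smolyak_setting R d)
    (Hi : forall d (n : 'I_d) l, (1 <= l)%N ->
      (op_norm (solution (X d) n) <= B%:E)%E /\
      (error x (prob (X d) n) (solution (X d) n) (block_op (X d) n l)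
         <= (C * D ^+ l)%:E)%E)
    (Hii : x = Randomized -> forall d (n : 'I_d) l, (1 <= l)%N ->
      (forall f : source (X d) n,
        borel_measurable (fun w => block_op (X d) n l w f) /\
        (\int[prob (X d) n]_w (`|block_op (X d) n l w f| ^+ 2)%:E < +oo)%E) /\
      (ball_sup (fun f => sqrte (\int[prob (X d) n]_w
         (`|block_op (X d) n l w f - block_op (X d) n (l - 1) w f| ^+ 2)%:E)%E)
       <= (E * D ^+ l)%:E)%E)
    (Hiii : x = WorstCase -> forall d (n : 'I_d) l, (1 <= l)%N ->
      let mu w := ball_sup (fun f => (`|block_op (X d) n l w f|)%:E) in
      [/\ forall w, (mu w < +oo)%E,
          measurable_fun setT mu,
          (sqrte (\int[prob (X d) n]_w (mu w ^+ 2)) < +oo)%E &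
          (sqrte (\int[prob (X d) n]_w ball_sup (fun f =>
             (`|block_op (X d) n l w f - block_op (X d) n (l - 1) w f|
                ^+ 2)%:E))
           <= (E * D ^+ l)%:E)%E])
    (Hiv : forall d (n : 'I_d) l, (1 <= l)%N ->
      ((Klow * K ^+ (l - 1) * (K - 1))%:E
         <= block_card (X d) l n - block_card (X d) (l - 1) n
         <= (Kup * K ^+ (l - 1) * (K - 1))%:E)%E) :
  let alpha := ln (1 / D) / ln K in
  exists C0 C1 : R, forall d L : nat, (1 <= d)%N -> (d <= L)%N ->
    let e := error x (prob_d (X d)) (solution_d (X d)) (smolyak (X d) L) in
    let N := fine (smolyak_card (X d) L) in
    (d = 1%N -> (e <= (C0 * C1 * N `^ (- alpha))%:E)%E) /\
    ((2 <= d)%N -> (1 <= smolyak_card (X d) L)%E ->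
      (e <= (C0 * C1 ^+ d *
             (1 + ln N / (d - 1)%:R) `^ ((d - 1)%:R * (alpha + 1)) *
             N `^ (- alpha))%:E)%E).
Proof.
move=> alpha.
have Kup1 : 1 <= Kup := le_trans Klow_ge1 Klow_le_Kup.
pose H := 1 + B / D + C + E; pose M := Kup * (K / (K - 1)).
have H1 : 1 <= H by have := divr_gt0 B_gt0 D_gt0; rewrite /H; lra.
have r1 : 1 <= K / (K - 1) by rewrite ler_pdivlMr ?subr_gt0 // mul1r gerBl; lra.
have M1 : 1 <= M by rewrite /M -[leLHS]mulr1 ler_pM.
(* The constant depends on K, D, M and H only, hence neither on the dimension nor on the level. *)
exists 1, (rate_const K D M H) => -[//|m] L _ mL e N.
have L1 : (1 <= L)%N by apply: leq_ltn_trans mL.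
have hD n l : (1 <= l)%N ->
    (mean_square x (prob (X m.+1) n) (@block_diff R m.+1 (X m.+1) n l) <=
      (E * D ^+ l)%:E)%E.
  move: Hii Hiii; case: (x) => [hii _|_ hiii] l1.
    by have [] := hii erefl _ n l l1.
  by have [] := hiii erefl _ n l l1.
have [] := @smolyak_setting_bounds R x B C E D Kup K m (X m.+1) B_gt0 C_gt0
  E_gt0 D_gt0 Kup1 K_gt1 (fun n => proj1 (Hi m.+1 n 1%N isT))
  (fun n l l1 => proj2 (Hi m.+1 n l l1)) hD
  (fun n l l1 => proj2 (andP (Hiv m.+1 n l l1))) L mL.
rewrite -/H -/M -/e; set c := #|_|%:R => eH cardM.
have card0 : (0 <= smolyak_card (X m.+1) L)%E.
  by apply: integral_ge0 => w _; rewrite /counting; case: asboolP => _;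
    rewrite ?lee_fin ?leey.
have cardN : (smolyak_card (X m.+1) L = N%:E)%E.
  by rewrite fineK // ge0_fin_numE // (le_lt_trans cardM) ?ltry.
have e1 := @expR1_ge1 R.
have H0 : 0 < H := lt_le_trans ltr01 H1.
have M0 : 0 < M := lt_le_trans ltr01 M1.
rewrite cardN lee_fin in cardM; rewrite mul1r; split=> [[m0]|m2].
  subst m; have c1 : c <= 1 by rewrite /c lern1 card_admissible1.
  (* At N = 0 the power N^(-alpha) would be 0. Positivity follows from the lower bound on m_L -
     m_{L-1}. *)
  have N0 : 0 < N.
    rewrite -lte_fin -cardN; apply: smolyak_card_gt0 => //.
    have /andP[h _] := Hiv 1%N ord0 L L1.
    apply: le_lt_trans (block_card_ge0 (X 1%N) (L - 1) ord0) _.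
    rewrite -sube_gt0; apply: lt_le_trans h; rewrite lte_fin.
    rewrite !mulr_gt0 ?exprn_gt0 ?subr_gt0 ?(lt_le_trans ltr01 Klow_ge1) //.
    exact: lt_trans ltr01 K_gt1.
  apply: (le_trans eH); rewrite lee_fin.
  apply: (@le_trans _ _ (2 * H * D ^+ L)).
    rewrite ler_wpM2r ?exprn_ge0 ?(ltW D_gt0) // expr1 ler_piMr //; lra.
  apply: rate_one => //; apply: (le_trans cardM).
  rewrite expr1 ler_wpM2r ?exprn_ge0 ?(ltW (lt_trans ltr01 K_gt1)) //.
  by rewrite ler_piMr // ltW.
rewrite cardN lee_fin => N1; have m1 : (1 <= m)%N by [].
have m0 : 0 < m%:R :> R by rewrite ltr0n.
rewrite subn1 /=; apply: (le_trans eH); rewrite lee_fin.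
have cle := @card_admissible_le R m L m1 L1; rewrite -/c in cle.
pose Q : R := 1 + L%:R / m%:R.
have Q0 : 0 <= Q by rewrite addr_ge0 // divr_ge0.
(* One more factor e puts the constants of both bounds to the power d = m + 1. *)
have cQ : c <= expR 1 ^+ m.+1 * Q ^+ m.
  apply: (le_trans cle); rewrite exprMn ler_wpM2r ?exprn_ge0 //.
  by rewrite ler_weXn2l.
have K0 : 0 <= K by rewrite ltW // (lt_trans ltr01).
have NM : N <= (M * expR 1) ^+ m.+1 * Q ^+ m * K ^+ L.
  apply: (le_trans cardM); rewrite [in leRHS]exprMn ler_wpM2r ?exprn_ge0 //.
  by rewrite -[leRHS]mulrA ler_wpM2l // exprn_ge0 // ltW.
rewrite mul1r; apply: le_trans (rate_many K_gt1 D_gt0 D_lt1 M1 H1 m1 N1 NM).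
rewrite [in leRHS]exprMn -/Q ler_wpM2r ?exprn_ge0 ?(ltW D_gt0) //.
by rewrite -[leRHS]mulrA ler_wpM2l // exprn_ge0 // mulr_ge0 // ltW.
Qed.
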